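(* Let $p\ge 5$ be an integer. There exists $N(p)$ such that for every integer $n\ge N(p)$ the Weyl polynomial $W^p_{\partial(B^n\times 0)}$ is not conservative: some of its roots do not belong to the imaginary axis.
   Context: $B^n$ is the closed Euclidean unit ball of $\mathbb{R}^n$ and $B^n\times 0=\{(x,0):x\in B^n\}\subset\mathbb{R}^{n+1}$. For a compact convex $U\subset\mathbb{R}^{n+1}$ (possibly with empty interior), the Minkowski polynomial is $M_U^{\mathbb{R}^{n+1}}(t)=\mathrm{Vol}_{n+1}(U+tB^{n+1})=\sum_{k=0}^{n+1} m_k^{\mathbb{R}^{n+1}}(U)t^k$ ($t\ge0$; this is a polynomial in $t$). The Weyl coefficients attached to $\partial U$ are $$k_{2l}(\partial U)=2^l\frac{\Gamma(l+\frac12+1)}{\Gamma(\frac12+1)}\,m_{2l+1}^{\mathbb{R}^{n+1}}(U),\qquad 0\le l\le [n/2],$$ and the Weyl polynomial of index $p$ is $$W^p_{\partial U}(t)=\sum_{l=0}^{[n/2]}\frac{2^{-l}\Gamma(\frac p2+1)}{\Gamma(\frac p2+l+1)}k_{2l}(\partial U)t^{2l},$$ considered for complex $t$. (When $U$ has empty interior, $\partial U$ is only a symbol, and these objects are attached to $U\subset\mathbb{R}^{n+1}$.) A polynomial is conservative if all its (complex) roots are purely imaginary (lie in $\{z:\mathrm{Re}\,z=0\}$) and simple. *)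

(* Defs.v *)
From HB Require Import structures.
From mathcomp Require Import all_boot all_order all_algebra.
From mathcomp Require Import all_classical all_reals all_analysis.
From mathcomp Require Import complex.

Set Implicit Arguments.
Unset Strict Implicit.
Unset Printing Implicit Defensive.
Import Order.TTheory GRing.Theory Num.Theory.
Import numFieldNormedType.Exports.

Local Open Scope classical_set_scope.
Local Open Scope ring_scope.

Section Lebesgue.
Context {R : realType}.
Notation mR := (measurableTypeR R).

Definition tuple_cons n (xt : mR * n.-tuple mR) : n.+1.-tuple mR :=
  [tuple of xt.1 :: xt.2].

Lemma measurable_tuple_cons n : measurable_fun [set: _] (@tuple_cons n).
Proof. exact: measurable_cons measurable_fst measurable_snd. Qed.

HB.instance Definition _ n :=
  isMeasurableFun.Build _ _ _ _ (@tuple_cons n) (@measurable_tuple_cons n).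

Section Product.
Context (n : nat) (mu : {sigma_finite_measure set (n.-tuple mR) -> \bar R}).

Definition lebesgue_prod : set (n.+1.-tuple mR) -> \bar R :=
  pushforward (@lebesgue_measure R \x mu)%E (@tuple_cons n).

Let lebesgue_prod0 : lebesgue_prod set0 = 0%E.
Proof. by rewrite /lebesgue_prod; exact: measure0. Qed.

Let lebesgue_prod_ge0 A : (0 <= lebesgue_prod A)%E.
Proof. by rewrite /lebesgue_prod; exact: measure_ge0. Qed.

Let lebesgue_prod_additive : semi_sigma_additive lebesgue_prod.
Proof. by rewrite /lebesgue_prod; exact: measure_semi_sigma_additive. Qed.

HB.instance Definition _ := isMeasure.Build _ _ _ lebesgue_prod
  lebesgue_prod0 lebesgue_prod_ge0 lebesgue_prod_additive.

Let lebesgue_prod_sigma_finite : sigma_finite setT lebesgue_prod.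
Proof.
have /sigma_finiteP[F [TF ndF Foo]] := sigma_finiteT (@lebesgue_measure R).
have /sigma_finiteP[G [TG ndG Goo]] := sigma_finiteT mu.
pose split (t : n.+1.-tuple mR) : mR * n.-tuple mR :=
  (tnth t ord0, [tuple of behead t]).
have msplit : measurable_fun [set: _] split.
  by apply: measurable_fun_pair; [exact: measurable_tnth|exact: measurable_behead].
have splitK : cancel (@tuple_cons n) split.
  by move=> [x t]; rewrite /split /tuple_cons /=; congr pair; exact: val_inj.
exists (fun k => split @^-1` (F k `*` G k)).
  rewrite -preimage_bigcup; apply/esym; rewrite -subTset => t _.
  have [i _ Fi] : (\bigcup_k F k) (split t).1 by rewrite -TF.
  have [j _ Gj] : (\bigcup_k G k) (split t).2 by rewrite -TG.
  exists (maxn i j) => //; split.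
  - by move: Fi; exact/subsetPset/ndF/leq_maxl.
  - by move: Gj; exact/subsetPset/ndG/leq_maxr.
move=> k; have [mF Fk] := Foo k; have [mG Gk] := Goo k; split.
  by rewrite -[X in measurable X]setTI; apply: msplit => //; exact: measurableX.
rewrite /lebesgue_prod /pushforward -comp_preimage.
rewrite (_ : split \o _ = id) ?preimage_id; last exact/funext.
by rewrite product_measure1E// lte_mul_pinfty// ge0_fin_numE.
Qed.

HB.instance Definition _ := Measure_isSigmaFinite.Build _ _ _ lebesgue_prod
  lebesgue_prod_sigma_finite.

End Product.

(* n-dimensional Lebesgue measure on the Borel sets of R^n, as the n-fold
   product of the one-dimensional Lebesgue measure. *)
Fixpoint lebesgue_tuple n : {sigma_finite_measure set (n.-tuple mR) -> \bar R} :=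
  match n with
  | 0 => \d_([tuple] : 0.-tuple mR)
  | m.+1 => lebesgue_prod (lebesgue_tuple m)
  end.

Definition volume d (A : set 'rV[R]_d) : \bar R :=
  lebesgue_tuple d [set t | A (\row_i tnth t i)].

End Lebesgue.

Section Weyl.
Context {R : realType}.

(* The library's norm on matrices is the sup norm. *)
Definition enorm d (x : 'rV[R]_d) : R := Num.sqrt (\sum_i x 0 i ^+ 2).

Definition eball d : set 'rV[R]_d := [set x | enorm x <= 1].

(* B^n x 0, whose interior in R^(n+1) is empty *)
Definition flat_ball n : set 'rV[R]_(n + 1) :=
  [set row_mx x 0 | x in @eball n].

Definition parallel_set d (U : set 'rV[R]_d) (t : R) : set 'rV[R]_d :=
  [set u + t *: b | u in U & b in @eball d].

Definition is_minkowski_poly d (U : set 'rV[R]_d) (M : {poly R}) : Prop :=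
  (size M <= d.+1)%N /\
  forall t : R, 0 <= t -> volume (parallel_set U t) = M.[t]%:E.

(* By Steiner's formula such a polynomial exists for every compact convex U, and
   it is unique by minkowski_polyE. The value 0 is junk, reached only for sets U
   that have no Minkowski polynomial. *)
Definition minkowski_poly d (U : set 'rV[R]_d) : {poly R} :=
  xget 0 (is_minkowski_poly U).

Lemma minkowski_polyE d (U : set 'rV[R]_d) (M : {poly R}) :
  is_minkowski_poly U M -> minkowski_poly U = M.
Proof.
move=> UM; apply: xget_unique => // M' [_ UM'].
apply/eqP; rewrite -subr_eq0; apply/eqP.
apply: (@roots_geq_poly_eq0 _ _ [seq k%:R | k <- iota 0 (size (M' - M))]).
- apply/allP => _ /mapP[k _ ->]; rewrite rootE hornerD hornerN subr_eq0.
  by apply/eqP/EFin_inj; rewrite -UM'// -UM.2.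
- by rewrite map_inj_uniq ?iota_uniq//; exact: mulrIn (oner_neq0 _).
- by rewrite size_map size_iota.
Qed.

Definition Gamma (a : R) : R :=
  \int[@lebesgue_measure R]_(x in `]0, +oo[) (x `^ (a - 1) * expR (- x)).

(* weyl_coef U l is the coefficient k_(2l) attached to the boundary of U. *)
Definition weyl_coef n (U : set 'rV[R]_(n + 1)) (l : nat) : R :=
  2 ^+ l * (Gamma (l%:R + 2^-1 + 1) / Gamma (2^-1 + 1))
    * (minkowski_poly U)`_(2 * l + 1)%N.

Definition weyl_poly (p n : nat) (U : set 'rV[R]_(n + 1)) : {poly R} :=
  \sum_(l < (n %/ 2).+1)
    (2 ^- l * Gamma (p%:R / 2 + 1) / Gamma (p%:R / 2 + l%:R + 1)
       * weyl_coef U l) *: 'X^(2 * l)%N.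

Definition complex_weyl_poly p n (U : set 'rV[R]_(n + 1)) : {poly R[i]} :=
  map_poly (real_complex R) (weyl_poly p U).

(* mup z P = 1 says that z is a simple root. *)
Definition conservative (P : {poly R[i]}) : Prop :=
  forall z : R[i], root P z -> complex.Re z = 0 /\ mup z P = 1%N.

End Weyl.

Arguments eball {R} d.
Arguments flat_ball R n : clear implicits.

(* Main.v *)
Require Import Defs.
From mathcomp Require Import all_boot all_order all_algebra.
From mathcomp Require Import all_classical all_reals all_analysis.
From mathcomp Require Import measurable_realfun.
From mathcomp Require Import complex.
From mathcomp Require Import ring lra.

Set Implicit Arguments.
Unset Strict Implicit.
Unset Printing Implicit Defensive.
Import Order.TTheory GRing.Theory Num.Theory.
Import numFieldNormedType.Exports.
Local Open Scope ring_scope.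

(** The parallel body of B^n x 0 at distance t consists of the points (x, s)
    with |s| <= t and |x| <= 1 + sqrt(t^2 - s^2). Integrating the volumes of the
    slices over s gives the Minkowski polynomial
    ([volume_parallel_flat_ball]); after the Gamma factors cancel, the Weyl
    polynomial of index p is a positive multiple of

      sum_l C(n, 2l) * l! / (p/2 + 1)_l * t^(2l),

    where (a)_l is the rising factorial ([weyl_poly_flat_ball]). Suppose that
    all its roots are imaginary. Then T(y), its value at i y / n divided by that
    multiple, is a polynomial in y with only real roots.

    The recurrence of its coefficients turns into a second order differential
    equation for T ([weyl_wave_ode]), which for large n is close to

      y^2 T'' + p y T' + (y^2 - p) T = - p.

    Far out, a solution has to follow the particular solution, whose leading
    term is - p / y^2. Indeed g = y^2 T + p satisfies the equation of an
    oscillator with friction (p - 4) / y and with a forcing of order 1 / y^2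
    ([lifted_wave_ode]). For p >= 5 the friction is at least 1 / y, so an energy
    estimate gives g -> 0 ([damped_oscillator_decay]), uniformly in n as long as
    y^4 <= n ([weyl_wave_asymptotic]).

    So on some interval [a, 3a] and for all large n, the polynomial T has no
    zero and is close to - p / y^2, the logarithm of whose absolute value is
    strictly convex. But a polynomial with only real roots is log-concave, in
    absolute value, between two consecutive roots ([real_rooted_midpoint]). This
    contradiction shows that some root of the Weyl polynomial is not
    imaginary. *)

(** * Lebesgue measure on tuples *)

Section TupleMeasure.
Local Open Scope classical_set_scope.
Local Open Scope ring_scope.
Context {R : realType}.
Notation mR := (measurableTypeR R).
Notation mu := (@lebesgue_measure R).

Lemma lebesgue_tupleS n (A : set (n.+1.-tuple mR)) :
  lebesgue_tuple n.+1 A =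
  (\int[mu]_x lebesgue_tuple n [set t : n.-tuple mR | A [tuple of x :: t]])%E.
Proof.
apply: eq_integral => x _ /=; congr (lebesgue_tuple n _).
by apply/seteqP; split => t /=; rewrite /xsection/= inE.
Qed.

Lemma measurable_rcons d (T : measurableType d) n (f : T -> n.-tuple mR)
    (g : T -> mR) :
  measurable_fun [set: T] f -> measurable_fun [set: T] g ->
  measurable_fun [set: T] (fun x => [the n.+1.-tuple mR of rcons (f x) (g x)]).
Proof.
move=> mf mg; apply/measurable_fun_tnthP => i.
have [ilt|ige] := ltnP i n.
  rewrite (_ : _ \o _ = (@tnth _ _)^~ (Ordinal ilt) \o f).
    by apply: measurableT_comp => //; exact: measurable_tnth.
  apply/funext => x /=.
  by rewrite !(tnth_nth (g x))/= nth_rcons size_tuple ilt.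
rewrite (_ : _ \o _ = g)//; apply/funext => x /=.
rewrite (tnth_nth (g x))/= nth_rcons size_tuple ltnNge ige/=.
by case: ifP.
Qed.

(** The measure on tuples is built by splitting off the first coordinate; by
    Tonelli's theorem the last one, along which [flat_ball] is flat, can be
    split off as well. *)
Lemma lebesgue_tuple_rcons n (A : set (n.+1.-tuple mR)) : measurable A ->
  lebesgue_tuple n.+1 A =
  (\int[mu]_x lebesgue_tuple n
     [set t : n.-tuple mR | A [tuple of rcons t x]])%E.
Proof.
elim: n A => [|n IH] A mA.
  rewrite lebesgue_tupleS; apply: eq_integral => x _.
  congr (lebesgue_tuple 0 _).
  by apply/seteqP; split => t /=; rewrite (tuple0 t); congr A; exact: val_inj.
rewrite lebesgue_tupleS.
under eq_integral.
  move=> x _; rewrite IH; last first.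
    rewrite -[X in measurable X]setTI.
    exact: (measurable_cons (measurable_cst x) (@measurable_id _ _ setT)).
  over.
pose B := [set z : (mR * mR) * n.-tuple mR |
    A [tuple of z.1.1 :: rcons z.2 z.1.2]].
have mB : measurable B.
  rewrite -[X in measurable X]setTI.
  have m1 : measurable_fun [set: (mR * mR) * n.-tuple mR] (fun z => z.1.1).
    exact: (measurableT_comp measurable_fst measurable_fst).
  have m2 : measurable_fun [set: (mR * mR) * n.-tuple mR] (fun z => z.1.2).
    exact: (measurableT_comp measurable_snd measurable_fst).
  exact: (measurable_cons m1 (measurable_rcons measurable_snd m2)).
have sectionB (z : mR * mR) : xsection B z =
    [set t : n.-tuple mR | A [tuple of z.1 :: rcons t z.2]].
  by apply/seteqP; split => t /=; rewrite /xsection/= inE.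
have := @fubini_tonelli _ _ _ _ R mu mu _
  (measurable_fun_xsection (lebesgue_tuple n) mB) (fun z => measure_ge0 _ _).
rewrite /= => fub.
transitivity (\int[mu]_x \int[mu]_y lebesgue_tuple n (xsection B (x, y)))%E.
  apply: eq_integral => x _; apply: eq_integral => y _.
  by rewrite sectionB; congr (lebesgue_tuple n _).
rewrite fub; apply: eq_integral => y _; rewrite lebesgue_tupleS.
apply: eq_integral => x _; rewrite sectionB; congr (lebesgue_tuple n _).
by apply/seteqP; split => t /=; congr A; exact: val_inj.
Qed.

End TupleMeasure.

(** * Chord integrals *)

Section ChordIntegral.
Local Open Scope classical_set_scope.
Local Open Scope ring_scope.
Context {R : realType}.
Notation mu := (@lebesgue_measure R).
Implicit Types (r s : R) (k : nat).

(** Half the length of the chord of the disk of radius [r] at height [s]. *)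
Definition half_chord r s : R := Num.sqrt (r ^+ 2 - s ^+ 2).

Lemma half_chord_sqr r s : `|s| <= r -> half_chord r s ^+ 2 = r ^+ 2 - s ^+ 2.
Proof.
move=> sr; rewrite /half_chord sqr_sqrtr// subr_ge0 -(real_normK (num_real s)).
by rewrite lerXn2r// nnegrE (le_trans _ sr).
Qed.

Lemma continuous_half_chord_exp r k : continuous (fun s => half_chord r s ^+ k).
Proof.
move=> s; apply: (@continuous_comp _ _ _ (half_chord r) (fun x => x ^+ k)).
  apply: (@continuous_comp _ _ _ (fun s => r ^+ 2 - s ^+ 2) Num.sqrt).
    by apply: cvgB; [exact: cvg_cst|exact: exprn_continuous].
  exact: sqrt_continuous.
exact: exprn_continuous.
Qed.

(** The ratio of the volumes of the unit balls in dimensions [k.+1] and [k]. *)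
Definition chord_integral k : R := \int[mu]_(s in `[-1, 1]) half_chord 1 s ^+ k.

Lemma continuous_derivable_oo_LRcontinuous (F : R -> R) a b :
  (forall x, derivable F x 1) -> derivable_oo_LRcontinuous F a b.
Proof.
move=> dF; have cF x : {for x, continuous F}.
  exact/differentiable_continuous/derivable1_diffP.
split; first by move=> *; exact: dF.
- exact/cvg_at_right_filter/cF.
- exact/cvg_at_left_filter/cF.
Qed.

Lemma integral_half_chord r k : 0 <= r ->
  (\int[mu]_(s in `[(- r)%R, r]) (half_chord r s ^+ k)%:E)%E
    = (r ^+ k.+1 * chord_integral k)%:E.
Proof.
rewrite le_eqVlt => /predU1P[<-|r0].
  by rewrite oppr0 set_itv1 integral_set1 exprS !mul0r.
pose F s := r * s.
have dF (x : R) : is_derive x 1 F r.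
  have := is_deriveZ r (is_derive_id x (1 : R)).
  by move/is_derive_eq; apply; rewrite /GRing.scale/= mulr1.
have F1E : F^`()%classic = cst r.
  by apply/funext => x; rewrite derive1E (@derive_val _ _ _ _ _ _ _ (dF x)).
have := @integration_by_substitution_increasing R F
  (fun s => half_chord r s ^+ k) (-1) 1.
rewrite F1E /F mulrN1 mulr1 => ->; first last.
- exact/continuous_subspaceT/continuous_half_chord_exp.
- by apply: continuous_derivable_oo_LRcontinuous => x; exact: ex_derive.
- exact: is_cvg_cst.
- exact: is_cvg_cst.
- by move=> x _; exact: cvg_cst.
- by move=> x y _ _ xy; rewrite ltr_pM2l.
- lra.
have scale x : half_chord r (r * x) = r * half_chord 1 x.
  rewrite /half_chord exprMn -{1}(mulr1 (r ^+ 2)) -mulrBr expr1n.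
  by rewrite sqrtrM ?sqr_ge0// sqrtr_sqr gtr0_norm.
under eq_integral.
  move=> x _; rewrite !fctE /= scale exprMn mulrAC -exprSr EFinM.
  over.
have intc :
    mu.-integrable `[-1, 1] (EFin \o (fun x : R => half_chord 1 x ^+ k)).
  apply: continuous_compact_integrable; first exact: segment_compact.
  exact/continuous_subspaceT/continuous_half_chord_exp.
rewrite integralZl//= EFinM; congr (_ * _)%E.
by rewrite /chord_integral /Rintegral fineK//; exact: integrable_fin_num.
Qed.

Lemma chord_integral0 : chord_integral 0 = 2.
Proof.
rewrite /chord_integral /Rintegral.
under eq_integral do rewrite expr0.
rewrite integral_cst//= mul1e lebesgue_measure_itv/= lte_fin.
by rewrite ifT; [rewrite /=; ring|lra].
Qed.

Lemma integrable_half_chord r k :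
  mu.-integrable `[(- r), r] (fun s : R => (half_chord r s ^+ k)%:E).
Proof.
apply: continuous_compact_integrable; first exact: segment_compact.
exact/continuous_subspaceT/continuous_half_chord_exp.
Qed.

(** The derivative of [s * (1 - s ^+ 2) ^+ l.+1] has integral [0] on [-1, 1]. *)
Lemma chord_integralSS l :
  (2 * l + 3)%:R * chord_integral (2 * l + 2)
    = (2 * l + 2)%:R * chord_integral (2 * l).
Proof.
pose P : {poly R} := 'X * (1 - 'X^2) ^+ l.+1.
pose f s := (2 * l + 3)%:R * half_chord 1 s ^+ (2 * l + 2)
  - (2 * l + 2)%:R * half_chord 1 s ^+ (2 * l).
have cf : continuous f.
  move=> s; apply: cvgB; apply: cvgMr; exact: continuous_half_chord_exp.
have dP : {in `]-1, 1[, (horner P)^`()%classic =1 f}.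
  move=> s /[!in_itv]/= /andP[s1 s2].
  rewrite -derive.derivE /P derivM deriv_exp !poly.derivE /=.
  rewrite !(hornerE, horner_exp) /=.
  rewrite /f (_ : (2 * l + 2 = 2 * l.+1)%N); last by rewrite mulnS addnC.
  rewrite !exprM half_chord_sqr ?expr1n; last first.
    by rewrite ler_norml; apply/andP; split; lra.
  rewrite mulnS !natrD ?natrM exprS hornerMn -[X in s * X]mulr_natr -natr1.
  rewrite !(hornerE, horner_exp) /=.
  by ring.
have := @continuous_FTC2 _ f (horner P) (-1) 1.
move=> /(_ ltac:(lra) (continuous_subspaceT cf) _ dP) H.
have {H} intf0 : \int[mu]_(s in `[-1, 1]) f s = 0.
  rewrite /Rintegral H; last exact: continuous_derivable_oo_LRcontinuous.
  rewrite /P !(hornerE, horner_exp) sqrrN expr1n subrr exprS !mul0r !mulr0.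
  by rewrite -EFinB subrr.
apply/eqP; rewrite -subr_eq0 -{}intf0 /f; apply/eqP.
rewrite RintegralB//=.
- by rewrite !RintegralZl//=; exact: integrable_half_chord.
- apply: (integrableZl _ _ (integrable_half_chord 1 (2 * l + 2))) => //.
- apply: (integrableZl _ _ (integrable_half_chord 1 (2 * l))) => //.
Qed.

End ChordIntegral.

(** * Volumes of balls and of parallel bodies *)

Section BallVolume.
Local Open Scope classical_set_scope.
Local Open Scope ring_scope.
Context {R : realType}.
Notation mR := (measurableTypeR R).
Notation mu := (@lebesgue_measure R).
Implicit Types (r s t : R) (k n : nat).

Definition unit_ball_volume n : R := \prod_(k < n) chord_integral k.

Lemma chord_integral_ge0 k : 0 <= @chord_integral R k.
Proof. by apply: Rintegral_ge0 => s _; rewrite exprn_ge0// sqrtr_ge0. Qed.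

Lemma unit_ball_volume_ge0 n : 0 <= unit_ball_volume n.
Proof. by apply: prodr_ge0 => k _; exact: chord_integral_ge0. Qed.

Definition tuple_ball n r : set (n.-tuple mR) :=
  [set x | \sum_i tnth x i ^+ 2 <= r ^+ 2].

(** Slicing the ball at height [s] leaves a ball of radius [half_chord r s] in
    one dimension less, which is how the product of chord integrals arises. *)
Lemma ball_volume n r : 0 <= r ->
  lebesgue_tuple n (@tuple_ball n r) = (unit_ball_volume n * r ^+ n)%:E.
Proof.
elim: n r => [|n IH] r r0.
  rewrite /= diracE mem_set /tuple_ball/= ?big_ord0 ?sqr_ge0//.
  by rewrite /unit_ball_volume big_ord0 mulr1.
rewrite lebesgue_tupleS.
transitivity (\int[mu]_(s in `[(- r)%R, r])
    ((unit_ball_volume n)%:E * (half_chord r s ^+ n)%:E))%E.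
  rewrite [RHS]integral_mkcond; apply: eq_integral => s _.
  have sumE (x : n.-tuple mR) : \sum_(i < n.+1) tnth [tuple of s :: x] i ^+ 2
      = s ^+ 2 + \sum_(i < n) tnth x i ^+ 2.
    by rewrite big_ord_recl tnth0; under eq_bigr do rewrite tnthS.
  rewrite patchE; case: ifPn => [|].
    rewrite inE/= in_itv/= -ler_norml => sr.
    rewrite -EFinM -IH ?sqrtr_ge0//; congr (lebesgue_tuple n _).
    rewrite /tuple_ball half_chord_sqr//.
    by apply/seteqP; split => x /=; rewrite sumE lerBrDl.
  rewrite notin_setE/= in_itv/= -ler_norml => /negP; rewrite -ltNge => rs.
  rewrite (_ : [set _ | _] = set0) ?measure0//.
  apply/seteqP; split => x //=; rewrite /tuple_ball/= sumE.
  move=> sr; have : s ^+ 2 <= r ^+ 2.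
    by apply: le_trans sr; rewrite lerDl sumr_ge0// => i _; rewrite sqr_ge0.
  by rewrite -(real_normK (num_real s)) leNgt ltrXn2r.
rewrite integralZl//; last exact: integrable_half_chord.
rewrite integral_half_chord// -EFinM; congr EFin.
by rewrite /unit_ball_volume big_ord_recr/=; ring.
Qed.

Lemma lebesgue_tuple_addn1 n (A : set ((n + 1).-tuple mR)) : measurable A ->
  lebesgue_tuple (n + 1) A =
  (\int[mu]_s lebesgue_tuple n
     [set x : n.-tuple mR | A [tuple of x ++ [:: s]]])%E.
Proof.
suff H m (e : m = n.+1) (B : set (m.-tuple mR)) : measurable B ->
    lebesgue_tuple m B = (\int[mu]_s lebesgue_tuple n
      [set x : n.-tuple mR | B (tcast (esym e) [tuple of rcons x s])])%E.
  move=> mA; rewrite (H _ (addn1 n))//; apply: eq_integral => s _.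
  congr (lebesgue_tuple n _); apply/seteqP.
  by split=> x /=; congr A; apply: val_inj; rewrite /= val_tcast/= cats1.
by subst m => mB; rewrite lebesgue_tuple_rcons.
Qed.

Lemma enorm_sqr d (x : 'rV[R]_d) : enorm x ^+ 2 = \sum_i x 0 i ^+ 2.
Proof. by rewrite sqr_sqrtr// sumr_ge0// => i _; rewrite sqr_ge0. Qed.

Lemma enorm_le d (x : 'rV[R]_d) r : 0 <= r ->
  (enorm x <= r) = (\sum_i x 0 i ^+ 2 <= r ^+ 2).
Proof. by move=> r0; rewrite -enorm_sqr ler_pXn2r// nnegrE// sqrtr_ge0. Qed.

Lemma enorm_ge0 d (x : 'rV[R]_d) : 0 <= enorm x.
Proof. exact: sqrtr_ge0. Qed.

Lemma enormZ d (c : R) (x : 'rV[R]_d) : enorm (c *: x) = `|c| * enorm x.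
Proof.
rewrite /enorm -sqrtr_sqr -sqrtrM ?sqr_ge0// mulr_sumr; congr Num.sqrt.
by apply: eq_bigr => i _; rewrite mxE exprMn.
Qed.

Lemma enorm_le0 d (x : 'rV[R]_d) : enorm x <= 0 -> x = 0.
Proof.
rewrite enorm_le// expr0n/= => x0; apply/rowP => i; rewrite mxE.
apply/eqP; rewrite -sqrf_eq0 eq_le sqr_ge0 andbT (le_trans _ x0)//.
by rewrite (bigD1 i)//= lerDl sumr_ge0// => j _; exact: sqr_ge0.
Qed.

(** For positive [a] and [b], weighting each coordinate by
    [2 * (a * b) * (u * v) <= (b * u) ^+ 2 + (a * v) ^+ 2] gives the triangle
    inequality without the Cauchy-Schwarz inequality. *)
Lemma enorm_add_le d (x y : 'rV[R]_d) a b : 0 <= a -> 0 <= b ->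
  enorm x <= a -> enorm y <= b -> enorm (x + y) <= a + b.
Proof.
move=> a0 b0 xa yb.
have [a00|an0] := eqVneq a 0.
  by rewrite (@enorm_le0 _ x) ?a00 ?add0r// -a00.
have [b00|bn0] := eqVneq b 0.
  by rewrite (@enorm_le0 _ y) ?b00 ?addr0// -b00.
have ab : 0 < a * b by rewrite mulr_gt0// lt_neqAle eq_sym ?an0 ?bn0.
move: xa yb; rewrite !enorm_le ?addr_ge0// => xa yb.
rewrite -(ler_pM2l ab) mulr_sumr.
apply: (@le_trans _ _ (\sum_i ((a * b + b ^+ 2) * x 0 i ^+ 2
                              + (a * b + a ^+ 2) * y 0 i ^+ 2))).
  apply: ler_sum => i _; rewrite mxE.
  by have := sqr_ge0 (b * x 0 i - a * y 0 i); lra.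
rewrite big_split/= -!mulr_sumr.
have h1 := ler_wpM2l (addr_ge0 (ltW ab) (sqr_ge0 b)) xa.
have h2 := ler_wpM2l (addr_ge0 (ltW ab) (sqr_ge0 a)) yb.
lra.
Qed.

Lemma enorm_row_mx n (x : 'rV[R]_n) (s : R) :
  enorm (row_mx x (const_mx s : 'rV_1)) ^+ 2 = enorm x ^+ 2 + s ^+ 2.
Proof.
rewrite !enorm_sqr big_split_ord/= big_ord1; congr (_ + _).
  by apply: eq_bigr => i _; rewrite row_mxEl.
by rewrite row_mxEr mxE.
Qed.

(** One direction is the triangle inequality. For the other one, the point of
    [flat_ball] closest to [(y, s)] is the radial truncation [c *: y] of [y] to
    the unit ball, at distance [enorm y - 1] from [y] when it is not [y]. *)
Lemma parallel_flat_ball n t (y : 'rV[R]_n) s : 0 <= t ->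
  parallel_set (flat_ball R n) t (row_mx y (const_mx s)) <->
  `|s| <= t /\ enorm y <= 1 + half_chord t s.
Proof.
move=> t0; split.
- move=> [_ [x x1 <-]] [b b1].
  rewrite -[b]hsubmxK scale_row_mx add_row_mx add0r => /eq_row_mx[yE sE].
  have b2E : rsubmx b = const_mx (rsubmx b 0 0) :> 'rV[R]_1.
    by apply/rowP => i; rewrite [RHS]mxE (ord1 i).
  move: b1; rewrite /eball/= -[b]hsubmxK b2E; set z := rsubmx b 0 0.
  set w := lsubmx b in yE *.
  rewrite -(@ler_pXn2r _ 2)// ?nnegrE ?enorm_ge0// enorm_row_mx expr1n => wz.
  have sz : s = t * z.
    have := congr1 (fun u : 'rV[R]_1 => u 0 0) sE.
    by rewrite [LHS]mxE [RHS]mxE => <-.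
  have z2 : z ^+ 2 <= 1 by have := sqr_ge0 (enorm w); lra.
  have st : `|s| <= t.
    rewrite sz normrM ger0_norm// ler_piMr//.
    by rewrite -(@ler_pXn2r _ 2)// ?nnegrE// expr1n real_normK// num_real.
  split => //; rewrite -yE; apply: enorm_add_le => //.
    exact: sqrtr_ge0.
  rewrite -(@ler_pXn2r _ 2)// ?nnegrE ?enorm_ge0 ?sqrtr_ge0// half_chord_sqr//.
  rewrite enormZ exprMn real_normK ?num_real// sz exprMn.
  have := ler_wpM2l (sqr_ge0 t) wz; lra.
- move=> [st y1].
  pose c := if enorm y <= 1 then 1 else (enorm y)^-1.
  have [cy yc] : enorm (c *: y) <= 1 /\ enorm (y - c *: y) <= half_chord t s.
    rewrite -[X in X - _]scale1r -scalerBl !enormZ /c.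
    case: (leP (enorm y) 1) => y1'.
      by rewrite normr1 mul1r subrr normr0 mul0r sqrtr_ge0.
    have y0 : 0 < enorm y by lra.
    rewrite gtr0_norm ?invr_gt0// mulVf ?gt_eqF//; split => //.
    rewrite ger0_norm ?subr_ge0 ?invf_le1// ?(ltW y1')//.
    by rewrite mulrBl mul1r mulVf ?gt_eqF//; lra.
  exists (row_mx (c *: y) 0); first by exists (c *: y).
  exists (t^-1 *: row_mx (y - c *: y) (const_mx s)).
    rewrite /eball/= enormZ -(@ler_pXn2r _ 2)// ?nnegrE ?mulr_ge0 ?enorm_ge0//.
    rewrite exprMn enorm_row_mx expr1n real_normK ?num_real//.
    have : enorm (y - c *: y) ^+ 2 <= half_chord t s ^+ 2.
      by rewrite lerXn2r// ?nnegrE ?enorm_ge0 ?sqrtr_ge0.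
    rewrite half_chord_sqr// => h.
    have [->|tn0] := eqVneq t 0; first by rewrite invr0 expr0n mul0r.
    have t2 : 0 < t ^+ 2 by rewrite exprn_even_gt0.
    by rewrite exprVn ler_pdivrMl// mulr1; lra.
  rewrite scalerA; have [t00|tn0] := eqVneq t 0.
    have s0 : s = 0 by apply/eqP; rewrite -normr_le0 -[leRHS]t00.
    have yc0 : y = c *: y.
      apply/eqP; rewrite -subr_eq0; apply/eqP/enorm_le0.
      by rewrite (le_trans yc)// /half_chord t00 s0 subrr sqrtr0.
    by rewrite t00 mul0r scale0r addr0 -yc0 s0; congr row_mx.
  rewrite mulfV// scale1r add_row_mx add0r; congr row_mx.
  by rewrite addrC subrK.
Qed.

End BallVolume.

Section FlatBall.
Local Open Scope classical_set_scope.
Local Open Scope ring_scope.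
Context {R : realType}.
Notation mR := (measurableTypeR R).
Notation mu := (@lebesgue_measure R).
Implicit Types (r s t : R) (k n : nat).

Lemma row_tuple_cat n (x : n.-tuple mR) s :
  \row_i tnth [tuple of x ++ [:: s]] i = row_mx (\row_i tnth x i) (const_mx s).
Proof.
apply/rowP => i; rewrite mxE; case: (split_ordP i) => j ->.
  by rewrite tnth_lshift row_mxEl mxE.
by rewrite tnth_rshift row_mxEr mxE (tnth_nth s) ord1.
Qed.

Definition parallel_tuples n t : set ((n + 1).-tuple mR) :=
  [set x | parallel_set (flat_ball R n) t (\row_i tnth x i)].

Lemma measurable_parallel_tuples n t : 0 <= t ->
  measurable (@parallel_tuples n t).
Proof.
move=> t0; pose s (x : (n + 1).-tuple mR) : R := tnth x (rshift n ord0).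
pose f (x : (n + 1).-tuple mR) : R := t - `|s x|.
pose g (x : (n + 1).-tuple mR) : R :=
  (1 + half_chord t (s x)) ^+ 2 - \sum_(i < n) tnth x (lshift 1 i) ^+ 2.
have ms : measurable_fun setT s by exact: measurable_tnth.
have mf : measurable_fun setT f.
  by apply: measurable_funB => //; exact: measurableT_comp.
have mg : measurable_fun setT g.
  apply: measurable_funB; last first.
    apply: measurable_sum => i; apply: measurable_funX; exact: measurable_tnth.
  apply: measurable_funX; apply: measurable_funD => //.
  apply: (@measurableT_comp _ _ _ _ _ _ (half_chord t)) => //.
  apply: continuous_measurable_fun.
  move=> u; have := @continuous_half_chord_exp R t 1 u; exact.
rewrite (_ : parallel_tuples t = f @^-1` `[0, +oo[ `&` g @^-1` `[0, +oo[).
  apply: measurableI; rewrite -[X in measurable X]setTI.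
    exact: mf.
  exact: mg.
have xE (x : (n + 1).-tuple mR) : \row_i tnth x i
    = row_mx (\row_i tnth x (lshift 1 i)) (const_mx (s x)).
  apply/rowP => i; rewrite mxE; case: (split_ordP i) => j ->.
    by rewrite row_mxEl mxE.
  by rewrite row_mxEr mxE ord1.
have h0 u : 0 <= 1 + half_chord t u by rewrite addr_ge0// sqrtr_ge0.
apply/seteqP; split => x; rewrite /parallel_tuples /= !in_itv/= !andbT xE.
  move=> /(parallel_flat_ball _ _ t0)[st]; rewrite enorm_le// => yx.
  rewrite !subr_ge0; split => //.
  by apply: le_trans yx; apply: ler_sum => i _; rewrite mxE.
rewrite !subr_ge0 => -[st yx]; apply/(parallel_flat_ball _ _ t0).
split => //; rewrite enorm_le//.
by apply: le_trans yx; apply: ler_sum => i _; rewrite mxE.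
Qed.

Definition flat_ball_minkowski n : {poly R} := \poly_(k < (n + 1).+1)
  (if k is j.+1 then unit_ball_volume n * 'C(n, j)%:R * chord_integral j
   else 0).

(** Integrating the slices: [unit_ball_volume n * (1 + half_chord t s) ^+ n] is
    expanded by the binomial theorem and integrated over [s]. *)
Lemma volume_parallel_flat_ball n t : 0 <= t ->
  volume (parallel_set (flat_ball R n) t) = (flat_ball_minkowski n).[t]%:E.
Proof.
move=> t0; rewrite /volume.
rewrite (lebesgue_tuple_addn1 (@measurable_parallel_tuples n t t0)).
set w : R := unit_ball_volume n.
transitivity (\int[mu]_(s in `[(- t)%R, t])
    (\sum_(k < n.+1) (w * 'C(n, k)%:R)%:E * (half_chord t s ^+ k)%:E))%E.
  rewrite [RHS]integral_mkcond; apply: eq_integral => s _.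
  rewrite patchE; case: ifPn => [|].
    rewrite inE/= in_itv/= -ler_norml => st.
    transitivity (lebesgue_tuple n (@tuple_ball R n (1 + half_chord t s))).
      congr (lebesgue_tuple n _); apply/seteqP.
      have h0 : 0 <= 1 + half_chord t s by rewrite addr_ge0// sqrtr_ge0.
      have sumE (x : n.-tuple mR) :
          \sum_i (\row_i tnth x i : 'rV[R]_n) 0 i ^+ 2 = \sum_i tnth x i ^+ 2.
        by apply: eq_bigr => i _; rewrite mxE.
      split => x; rewrite /parallel_tuples /= row_tuple_cat /tuple_ball/=.
        by move=> /(parallel_flat_ball _ _ t0)[_]; rewrite enorm_le// sumE.
      by move=> h; apply/(parallel_flat_ball _ _ t0); rewrite enorm_le// sumE.
    rewrite ball_volume ?addr_ge0 ?sqrtr_ge0// addrC exprD1n mulr_sumr -sumEFin.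
    apply: eq_bigr => k _; rewrite -EFinM -mulr_natr; congr EFin.
    by rewrite /w mulrA mulrAC.
  rewrite notin_setE/= in_itv/= -ler_norml => st.
  rewrite (_ : [set _ | _] = set0) ?measure0//.
  apply/seteqP; split => x //=; rewrite /parallel_tuples /= row_tuple_cat.
  by move=> /(parallel_flat_ball _ _ t0)[].
have w0 k : 0 <= w * 'C(n, k)%:R by rewrite mulr_ge0 ?unit_ball_volume_ge0.
rewrite ge0_integral_sum//; first last.
- by move=> k s _; rewrite -EFinM lee_fin mulr_ge0// exprn_ge0// sqrtr_ge0.
- move=> k; apply: measurable_int.
  exact: (integrableZl _ _ (integrable_half_chord t k)).
rewrite horner_poly -sumEFin addn1 [RHS]big_ord_recl/= mul0r add0e.
apply: eq_bigr => k _; rewrite integralZl//; last exact: integrable_half_chord.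
by rewrite integral_half_chord// -EFinM; congr EFin; rewrite /w/=; ring.
Qed.

Lemma is_minkowski_poly_flat_ball n :
  is_minkowski_poly (flat_ball R n) (flat_ball_minkowski n).
Proof. by split; [exact: size_poly|exact: volume_parallel_flat_ball]. Qed.

Lemma minkowski_poly_flat_ball_coef n l : (2 * l <= n)%N ->
  (minkowski_poly (flat_ball R n))`_(2 * l + 1)
    = unit_ball_volume n * 'C(n, 2 * l)%:R * chord_integral (2 * l).
Proof.
move=> ln; rewrite (minkowski_polyE (is_minkowski_poly_flat_ball n)).
by rewrite coef_poly addn1/= !addn1 ltnS ltnS ln.
Qed.

End FlatBall.

(** * The Gamma function *)

Definition rising_fact (R : pzSemiRingType) (a : R) (l : nat) : R :=
  \prod_(j < l) (a + j%:R).

Lemma rising_fact0 (R : pzSemiRingType) (a : R) : rising_fact a 0 = 1.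
Proof. exact: big_ord0. Qed.

Lemma rising_factS (R : pzSemiRingType) (a : R) l :
  rising_fact a l.+1 = rising_fact a l * (a + l%:R).
Proof. by rewrite /rising_fact big_ord_recr. Qed.

Lemma rising_fact_gt0 (R : numDomainType) (a : R) l :
  0 < a -> 0 < rising_fact a l.
Proof. by move=> a0; apply: prodr_gt0 => j _; rewrite ltr_pwDl. Qed.

Section GammaFunction.
Local Open Scope classical_set_scope.
Local Open Scope ring_scope.
Context {R : realType}.
Notation mu := (@lebesgue_measure R).
Implicit Types (a x y : R).

Definition gamma_integrand a x : R := x `^ (a - 1) * expR (- x).

Lemma gamma_integrand_ge0 a x : 0 <= gamma_integrand a x.
Proof. by rewrite mulr_ge0 ?powR_ge0 ?expR_ge0. Qed.

Lemma measurable_gamma_integrand a (D : set R) :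
  measurable_fun D (gamma_integrand a).
Proof.
apply: measurable_funTS; apply: measurable_funM; first exact: measurable_powR.
by apply: measurableT_comp => //; exact: measurableT_comp.
Qed.

(** Half of the exponential decay absorbs the power of [x], which leaves a
    multiple of an integrable exponential density. *)
Lemma gamma_integrand_le a : 1 <= a -> exists2 C, 0 <= C &
  forall x, 0 < x -> gamma_integrand a x <= C * exponential_pdf 2^-1 x.
Proof.
move=> a1; set m := Num.truncn (a - 1).
have am : a - 1 <= m.+1%:R by exact/ltW/truncnS_gt.
pose c : R := 2 ^+ m.+1 * m.+1`!%:R.
have c1 : 1 <= c.
  by rewrite /c -natrX -natrM ler1n muln_gt0 expn_gt0 fact_gt0.
exists (2 * c); first lra.
move=> x x0.
have xm : x `^ (a - 1) <= 1 + x ^+ m.+1.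
  have [x1|x1] := leP x 1.
    apply: (@le_trans _ _ 1); last by rewrite lerDl exprn_ge0// ltW.
    have a0 : 0 <= a - 1 by rewrite subr_ge0.
    by have := ge0_ler_powR a0 (ltW x0) ler01 x1; rewrite powR1.
  apply: (@le_trans _ _ (x ^+ m.+1)); last by rewrite lerDr.
  by rewrite -powR_mulrn ?(ltW x0)//; apply: ler_powR => //; exact: ltW.
have xe : 1 + x ^+ m.+1 <= c * expR (x / 2).
  have x20 : 0 <= x / 2 by rewrite divr_ge0// ltW.
  apply: le_trans (ler_wpM2l (le_trans ler01 c1) (expR_ge1Dxn m x20)).
  rewrite mulrDr mulr1 lerD// le_eqVlt; apply/orP; left; apply/eqP.
  rewrite /c exprMn exprVn; field.
  by rewrite expf_neq0// pnatr_eq0 -lt0n fact_gt0.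
rewrite exponential_pdfE ?(ltW x0)// /gamma_integrand.
apply: le_trans (ler_wpM2r (expR_ge0 _) (le_trans xm xe)) _.
rewrite -mulrA -expRD le_eqVlt; apply/orP; left; apply/eqP.
rewrite (_ : x / 2 + - x = - 2^-1 * x); last by field.
by field.
Qed.

Lemma integrable_gamma a : 1 <= a ->
  mu.-integrable `]0, +oo[ (EFin \o gamma_integrand a).
Proof.
move=> a1; have [C C0 hC] := gamma_integrand_le a1.
apply: (@le_integrable _ _ _ mu _ _ _
  (EFin \o (fun x => C * exponential_pdf 2^-1 x))) => //.
- by apply/measurable_EFinP; exact: measurable_gamma_integrand.
- move=> x /=; rewrite in_itv/= andbT => x0.
  rewrite lee_fin !ger0_norm ?gamma_integrand_ge0 ?hC//.
  by rewrite mulr_ge0// exponential_pdf_ge0.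
- have H : mu.-integrable setT (EFin \o exponential_pdf (2^-1 : R)).
    by apply: integrable_exponential_pdf; lra.
  apply: (integrableS _ _ (@subsetT _ _)) => //.
  exact: (integrableZl measurableT C H).
Qed.

Lemma GammaE a : 1 <= a -> (Gamma a)%:E =
  (\int[mu]_(x in `]0%R, +oo[) (gamma_integrand a x)%:E)%E.
Proof.
by move=> a1; rewrite fineK//; exact: integrable_fin_num (integrable_gamma a1).
Qed.

Lemma Gamma_gt0 a : 1 <= a -> 0 < Gamma a.
Proof.
move=> a1; rewrite -lte_fin GammaE//.
have sub : [set` `[1, 2]] `<=` [set` `]0 : R, +oo[].
  move=> x /=; rewrite !in_itv/= andbT => /andP[x1 _].
  by rewrite (lt_le_trans ltr01).
have mE : measurable_fun (`]0, +oo[ : set R) (EFin \o gamma_integrand a).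
  by apply/measurable_EFinP; exact: measurable_gamma_integrand.
apply: (@lt_le_trans _ _ (\int[mu]_(x in `[1%R, 2%R]) (expR (- 2))%:E)%E).
  rewrite integral_cst//= lebesgue_measure_itv/= lte_fin ifT; last lra.
  by rewrite -EFinM lte_fin mulr_gt0 ?expR_gt0//; lra.
apply: (@le_trans _ _ (\int[mu]_(x in `[1%R, 2%R]) (gamma_integrand a x)%:E)%E).
  apply: ge0_le_integral => //.
  - exact: (measurable_funS _ sub mE).
  - move=> x /=; rewrite in_itv/= => /andP[x1 x2]; rewrite lee_fin.
    rewrite -[leLHS]mul1r ler_pM ?expR_ge0 ?ler_expR ?lerN2//.
    by have := ler_powR x1 (_ : 0 <= a - 1); rewrite powRr0 subr_ge0; exact.
apply: ge0_subset_integral => //.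
by move=> x _; rewrite lee_fin gamma_integrand_ge0.
Qed.

Lemma gamma_integrand_parts a u v : 1 <= a -> 0 < u -> u < v ->
  \int[mu]_(x in `[u, v]) gamma_integrand (a + 1) x
    = a * \int[mu]_(x in `[u, v]) gamma_integrand a x
      + (gamma_integrand (a + 1) u - gamma_integrand (a + 1) v).
Proof.
move=> a1 u0 uv; set g1 := gamma_integrand (a + 1); set g := gamma_integrand a.
have dg b x : 0 < x -> is_derive x 1 (gamma_integrand b)
    ((b - 1) * gamma_integrand (b - 1) x - gamma_integrand b x).
  move=> x0.
  have dN : is_derive x 1 (fun y => expR (- y)) (- expR (- x)).
    have := is_derive1_comp (is_derive_expR (- x)) (is_deriveNid x 1).
    by move/is_derive_eq; apply; rewrite mulrN1.
  have := is_deriveM (is_derive1_powR (b - 1) x0) dN.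
  by move/is_derive_eq; apply; rewrite /GRing.scale/= /gamma_integrand; ring.
have cg b : {within `[u, v], continuous (gamma_integrand b)}.
  apply: derivable_within_continuous => x /[!in_itv]/= /andP[ux _].
  by apply: ex_derive; apply: dg; exact: lt_le_trans ux.
have ig b : mu.-integrable `[u, v] (EFin \o gamma_integrand b).
  by apply: continuous_compact_integrable => //; exact: segment_compact.
have LR : derivable_oo_LRcontinuous g1 u v.
  have cx x : 0 < x -> {for x, continuous g1}.
    move=> x0; apply/differentiable_continuous/derivable1_diffP.
    by apply: ex_derive; exact: dg.
  split.
  - move=> x /[!in_itv]/= /andP[ux _]; apply: ex_derive; apply: dg.
    exact: lt_trans ux.
  - exact/cvg_at_right_filter/cx.
  - by apply/cvg_at_left_filter/cx; exact: lt_trans uv.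
have := @continuous_FTC2 _ (fun x => a * g x - g1 x) g1 u v uv.
have cf : {within `[u, v], continuous (fun x => a * g x - g1 x)}.
  move=> x; apply: cvgB; last exact: cg.
  by apply: cvgMr; exact: cg.
move=> /(_ cf LR) H.
have {H} : \int[mu]_(x in `[u, v]) (a * g x - g1 x) = g1 v - g1 u.
  rewrite /Rintegral H// => x /[!in_itv]/= /andP[ux _].
  rewrite derive1E (@derive_val _ _ _ _ _ _ _ (dg _ x (lt_trans u0 ux))).
  by rewrite addrK.
rewrite RintegralB//.
- by rewrite RintegralZl//; [lra|exact: ig].
- by apply: (integrableZl _ _ (ig a)).
- exact: ig.
Qed.

(** Integration by parts is carried out on compact intervals inside the open
    half-line, where the integrand is differentiable; the boundary terms vanish
    as the intervals exhaust the half-line. *)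
Lemma GammaS a : 1 <= a -> Gamma (a + 1) = a * Gamma a.
Proof.
move=> a1.
pose A k : set R := [set` `[k.+1%:R^-1, k.+2%:R]].
have A_nd : {homo A : n m / (n <= m)%N >-> (n <= m)%O}.
  move=> n m nm; apply/subsetPset => x /=.
  rewrite /A/= !in_itv/= => /andP[nx xn].
  apply/andP; split; last by rewrite (le_trans xn)// ler_nat.
  by rewrite (le_trans _ nx)// lef_pV2 ?posrE ?ltr0n// ler_nat.
have A_cup : \bigcup_k A k = [set` `]0, +oo[].
  apply/seteqP; split => x /=.
    move=> [k _]; rewrite /A/= !in_itv/= andbT => /andP[kx _].
    by rewrite (lt_le_trans _ kx)// invr_gt0 ltr0n.
  rewrite in_itv/= andbT => x0.
  pose k := maxn (Num.truncn x) (Num.truncn x^-1).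
  exists k => //; rewrite /A/= in_itv/=; apply/andP; split.
    rewrite -[leRHS]invrK lef_pV2 ?posrE ?invr_gt0 ?ltr0n//.
    by rewrite (le_trans (ltW (truncnS_gt _)))// ler_nat ltnS leq_maxr.
  rewrite (le_trans (ltW (truncnS_gt _)))// ler_nat.
  by rewrite (leq_trans _ (leqnSn _))// ltnS leq_maxl.
have cvgG b : 1 <= b ->
    \int[mu]_(x in A k) gamma_integrand b x @[k --> \oo] --> Gamma b.
  move=> b1; apply: fine_cvg; rewrite GammaE// -A_cup.
  apply: ge0_nondecreasing_set_cvg_integral => //.
  - by move=> k; exact: measurable_itv.
  - by move=> k; apply/measurable_EFinP; exact: measurable_gamma_integrand.
  - by move=> k x _; rewrite lee_fin gamma_integrand_ge0.
have a2 : 1 <= a + 1 by lra.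
pose B k : R :=
  gamma_integrand (a + 1) k.+1%:R^-1 - gamma_integrand (a + 1) k.+2%:R.
have B_cvg0 : B k @[k --> \oo] --> (0 : R).
  have [C C0 hC] := gamma_integrand_le a2.
  have lim0 (f : nat -> R) M : (forall k, 0 <= f k <= M * k.+1%:R^-1) ->
      f k @[k --> \oo] --> (0 : R).
    move=> fM; apply: (@squeeze_cvgr _ _ _ _ (cst 0) (fun k => M * k.+1%:R^-1)).
    - by apply: nearW => k; exact: fM.
    - exact: cvg_cst.
    - by rewrite -[0](mulr0 M); apply: cvgMr; exact: cvg_harmonic.
  rewrite -(subr0 0); apply: cvgB.
    apply: (lim0 _ 1) => k; rewrite gamma_integrand_ge0 mul1r /gamma_integrand.
    have u0 : 0 < k.+1%:R^-1 :> R by rewrite invr_gt0 ltr0n.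
    have u1 : k.+1%:R^-1 <= 1 :> R by rewrite invf_le1 ?ltr0n// ler1n.
    rewrite addrK -[leRHS]mulr1 ler_pM ?powR_ge0 ?expR_ge0//.
      by apply: ge1r_powR; rewrite ?u0.
  apply: (lim0 _ C) => k; rewrite gamma_integrand_ge0/=.
  have v0 : 0 < k.+2%:R :> R by rewrite ltr0n.
  rewrite (le_trans (hC _ v0))// ler_wpM2l// exponential_pdfE ?(ltW v0)//.
  have := expR_ge1Dx (k.+2%:R / 2 : R).
  rewrite mulNr expRN [2^-1 * k.+2%:R]mulrC => ve.
  have e0 := expR_gt0 (k.+2%:R / 2 : R).
  have k0 : 0 < k.+1%:R :> R by rewrite ltr0n.
  rewrite -invfM lef_pV2 ?posrE ?mulr_gt0//.
  by move: ve; rewrite -[k.+2%:R]natr1; lra.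
have BE k : B k = \int[mu]_(x in A k) gamma_integrand (a + 1) x
    - a * \int[mu]_(x in A k) gamma_integrand a x.
  rewrite /A gamma_integrand_parts//; first by rewrite addrC addKr.
  apply: (@le_lt_trans _ _ 1); last by rewrite ltr1n.
  by rewrite invf_le1 ?ltr0n// ler1n.
have : B k @[k --> \oo] --> Gamma (a + 1) - a * Gamma a.
  have -> : B = (fun k => \int[mu]_(x in A k) gamma_integrand (a + 1) x)
      \- (fun k => a * \int[mu]_(x in A k) gamma_integrand a x).
    by apply/funext => k; exact: BE.
  have c1 := cvgG _ a2.
  have c2 : a * \int[mu]_(x in A k) gamma_integrand a x @[k --> \oo]
      --> a * Gamma a by apply: cvgMr; exact: cvgG.
  exact: (cvgB c1 c2).
move=> /(cvg_unique (@Rhausdorff R) B_cvg0)/eqP.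
by rewrite eq_sym subr_eq0 => /eqP.
Qed.

Lemma Gamma_rising a l : 1 <= a ->
  Gamma (a + l%:R) = rising_fact a l * Gamma a.
Proof.
move=> a1; elim: l => [|l IH]; first by rewrite rising_fact0 mul1r addr0.
rewrite -natr1 addrA GammaS; last by rewrite (le_trans a1)// lerDl.
by rewrite IH rising_factS; ring.
Qed.

End GammaFunction.

(** * Damped oscillators *)

Section DampedOscillator.
Context {R : realType}.
Implicit Types (g : {poly R}) (q K y : R).

(** This is [y] times the energy [g ^+ 2 + g' ^+ 2], corrected in two ways. The
    friction [q / y] acts on [g'] only; the cross term [q * g * g'] shares it
    between [g] and [g']. The constant [2 * K] pays for the forcing. *)
Definition oscillator_energy q K g : {poly R} :=
  'X * (g ^+ 2 + g^`() ^+ 2) + q *: (g * g^`()) + (2 * K)%:P.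

Lemma oscillator_energyE q K g y : (oscillator_energy q K g).[y] =
  y * (g.[y] ^+ 2 + g^`().[y] ^+ 2) + q * (g.[y] * g^`().[y]) + 2 * K.
Proof. by rewrite /oscillator_energy !(hornerE, horner_exp). Qed.

Lemma oscillator_energy_ge q K g y : 0 <= q -> 0 <= K -> q <= y ->
  y * g.[y] ^+ 2 <= 2 * (oscillator_energy q K g).[y].
Proof.
move=> q0 K0 qy; rewrite oscillator_energyE.
set u := g.[y]; set v := g^`().[y].
have h : q * (- (u ^+ 2 + v ^+ 2)) <= q * (2 * (u * v)).
  by rewrite ler_wpM2l//; have := sqr_ge0 (u + v); rewrite -subr_ge0; nra.
have : q * (u ^+ 2 + v ^+ 2) <= y * (u ^+ 2 + v ^+ 2).
  by rewrite ler_wpM2r// addr_ge0// sqr_ge0.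
have : 0 <= y * v ^+ 2 by rewrite mulr_ge0 ?sqr_ge0//; lra.
lra.
Qed.

(** The friction, the cross term and the growth of the factor [y] together
    contribute [2 * (1 - q) * y * (g ^+ 2 + g' ^+ 2)] to the left side, which is
    nonpositive since [1 <= q]. What remains, namely a multiple of the product of [g] and [g'] and the forcing, has coefficients bounded
    independently of [y], so for large [y] the energy dominates it. *)
Lemma oscillator_energy_deriv q K g y : 1 <= q -> 0 <= K -> q <= y ->
  q ^+ 2 + q + 12 * K <= y ->
  `|y ^+ 2 * g^`()^`().[y] + q * y * g^`().[y] + y ^+ 2 * g.[y]|
    <= K * (1 + `|g.[y]| + `|g^`().[y]|) ->
  2 * y * (oscillator_energy q K g)^`().[y] <= (oscillator_energy q K g).[y].
Proof.
move=> q1 K0 qy yK; rewrite oscillator_energyE /oscillator_energy.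
rewrite !(poly.derivE, hornerE, horner_exp) /=.
set u := g.[y]; set v := g^`().[y]; set w := g^`()^`().[y].
set r := (X in `|X| <= _) => hr.
have y0 : 0 < y by lra.
have -> : w = (r - q * y * v - y ^+ 2 * u) / y ^+ 2.
  rewrite /r; field; lra.
move: hr; move: {w} r => r hr.
set E := u ^+ 2 + v ^+ 2.
have E0 : 0 <= E by rewrite addr_ge0// sqr_ge0.
rewrite (_ : 2 * y * _ = 2 * (1 - q) * (y * E) - 2 * q ^+ 2 * (u * v)
    + (4 * v * r + 2 * (q / y) * (u * r))); last first.
  by rewrite /E; field; lra.
have forcing : 4 * v * r + 2 * (q / y) * (u * r) <= 2 * K + 12 * K * E.
  apply: (@le_trans _ _ (4 * (`|u| + `|v|) * (K * (1 + `|u| + `|v|)))).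
    apply: (@le_trans _ _ (4 * (`|u| + `|v|) * `|r|)); last first.
      by rewrite ler_wpM2l// mulr_ge0// addr_ge0.
    have m0 : 0 <= q / y by rewrite divr_ge0//; lra.
    have m1 : q / y <= 1 by rewrite ler_pdivrMr ?mul1r.
    move: {+}(q / y) m0 m1 => m m0 m1.
    rewrite (_ : _ + _ = (4 * v + 2 * m * u) * r); last by ring.
    rewrite (le_trans (ler_norm _))// normrM ler_wpM2r//.
    rewrite (le_trans (ler_normD _ _))// !normrM !normr_nat (ger0_norm m0).
    have := ler_wpM2r (normr_ge0 u) m1; have := normr_ge0 u; lra.
  have := sqr_ge0 (`|u| - `|v|); have := sqr_ge0 (`|u| + `|v| - 1).
  rewrite /E -(real_normK (num_real u)) -(real_normK (num_real v)).
  move: {+}`|u| {+}`|v| => U V h1 h2.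
  have : K * (4 * (U + V) * (1 + U + V)) <= K * (2 + 12 * (U ^+ 2 + V ^+ 2)).
    by rewrite ler_wpM2l//; nra.
  lra.
have cross : - (2 * q ^+ 2 + q) * (u * v) <= (q ^+ 2 + q) * E.
  have : (2 * q ^+ 2 + q) * (- 2 * (u * v)) <= (2 * q ^+ 2 + q) * E.
    rewrite ler_wpM2l//; first by rewrite addr_ge0 ?mulr_ge0 ?sqr_ge0//; lra.
    by rewrite /E; have := sqr_ge0 (u + v); nra.
  have : 0 <= q * E by rewrite mulr_ge0//; lra.
  lra.
have : (q ^+ 2 + q + 12 * K) * E <= y * E by rewrite ler_wpM2r.
have : 0 <= (q - 1) * (y * E) by rewrite mulr_ge0 ?mulr_ge0//; lra.
lra.
Qed.

(** Solutions of [g'' + (q / y) * g' + g = O(1 / y ^+ 2)] decay: by the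
    differential inequality the energy divided by [Num.sqrt y] does not
    increase, while the energy dominates [y * g ^+ 2]. *)
Lemma damped_oscillator_decay q K a b g : 1 <= q -> 0 <= K ->
    q <= a -> q ^+ 2 + q + 12 * K <= a ->
    (forall y, a <= y <= b ->
      `|y ^+ 2 * g^`()^`().[y] + q * y * g^`().[y] + y ^+ 2 * g.[y]|
        <= K * (1 + `|g.[y]| + `|g^`().[y]|)) ->
  forall y, a <= y <= b ->
    Num.sqrt y * g.[y] ^+ 2
      <= 2 * ((oscillator_energy q K g).[a] / Num.sqrt a).
Proof.
move=> q1 K0 qa Ka gode y /andP[ay yb].
have a0 : 0 < a by lra.
have y0 : 0 < y by lra.
set F := oscillator_energy q K g.
pose G (z : R) := F.[z] * z `^ (- 2^-1).
have dG (z : R) : 0 < z ->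
    is_derive z 1 G (F^`().[z] * z `^ (- 2^-1)
      + F.[z] * (- 2^-1 * z `^ (- 2^-1 - 1))).
  move=> z0.
  have := is_deriveM (is_derive_poly F z) (is_derive1_powR (- 2^-1) z0).
  by move=> /is_derive_eq; apply; rewrite /GRing.scale/= addrC (mulrC (z `^ _)).
have dG0 (z : R) : a <= z <= b -> G^`()%classic z <= 0.
  move=> /andP[az zb]; have z0 : 0 < z by lra.
  rewrite derive1E (@derive_val _ _ _ _ _ _ _ (dG z z0)).
  rewrite powRB; last by apply/implyP => _; rewrite gt_eqF.
  rewrite powRr1 ?(ltW z0)//.
  have := oscillator_energy_deriv q1 K0 (le_trans qa az) (le_trans Ka az)
    (gode z _).
  rewrite az zb -/F => /(_ isT) hF.
  rewrite (_ : _ + _ = (2 * z * F^`().[z] - F.[z]) * (z `^ (- 2^-1) / (2 * z))).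
    rewrite mulr_le0_ge0 ?subr_le0//.
    by rewrite divr_ge0 ?powR_ge0// mulr_ge0 ?(ltW z0).
  by field; lra.
have le_G : G y <= G a.
  have dab (z : R) : a <= z <= b -> derivable G z 1.
    by move=> /andP[az zb]; apply: ex_derive; apply: dG; lra.
  apply: (@ler0_derive1_le_cc _ G a b); last exact: ay.
  - by move=> z /itvP zab; apply: dab; rewrite !zab.
  - by move=> z /itvP zab; apply: dG0; rewrite !zab.
  - apply: derivable_within_continuous => z /itvP zab.
    by apply: dab; rewrite !zab.
  - by rewrite in_itv/= ay yb.
  - by rewrite in_itv/= lexx (le_trans ay).
have sqrtV (z : R) : 0 < z -> z `^ (- 2^-1) = (Num.sqrt z)^-1.
  by move=> z0; rewrite powRN powR12_sqrt// ltW.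
have -> : F.[a] / Num.sqrt a = G a by rewrite /G sqrtV.
apply: le_trans (ler_wpM2l (ler0n _ 2) le_G).
have sy : 0 < Num.sqrt y by rewrite sqrtr_gt0.
rewrite /G sqrtV// [leRHS]mulrA ler_pdivlMr// mulrAC -expr2.
rewrite sqr_sqrtr ?(ltW y0)//.
by apply: oscillator_energy_ge => //; lra.
Qed.

End DampedOscillator.

(** * The Weyl polynomial along the imaginary axis *)

Section WeylWave.
Context {R : realType}.
Implicit Types (p y : R) (n : nat).

Definition weyl_ratio p (l : nat) : R := l`!%:R / rising_fact (p / 2 + 1) l.

(** Up to a positive factor, this is the value of the Weyl polynomial at
    [i * y / n]. The scaling by [n] makes the coefficients converge as [n]
    grows. *)
Definition weyl_wave p n : {poly R} :=
  \poly_(k < n.+1) (if odd k then 0 else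
    (-1) ^+ k./2 * weyl_ratio p k./2 * ('C(n, k)%:R / n%:R ^+ k)).

Lemma coef_weyl_wave p n k : (weyl_wave p n)`_k = if odd k then 0 else
  (-1) ^+ k./2 * weyl_ratio p k./2 * ('C(n, k)%:R / n%:R ^+ k).
Proof.
rewrite coef_poly ltnS; case: leqP => // nk.
by rewrite bin_small// mul0r mulr0 if_same.
Qed.

Lemma weyl_ratioS p l : 0 <= p ->
  (2 * l.+1%:R + p) * weyl_ratio p l.+1 = 2 * l.+1%:R * weyl_ratio p l.
Proof.
move=> p0; rewrite /weyl_ratio rising_factS factS natrM -natr1.
have p2 : 0 < p / 2 + 1 by lra.
have := rising_fact_gt0 l p2; have := ler0n R l.
by move=> l0 h; field; rewrite gt_eqF//= gt_eqF//; lra.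
Qed.

Lemma weyl_ratio01 p l : 0 <= p -> 0 <= weyl_ratio p l <= 1.
Proof.
move=> p0; elim: l => [|l /andP[IH0 IH1]].
  by rewrite /weyl_ratio rising_fact0 divr1 ler01 lexx.
have l0 : 0 < l.+1%:R :> R by rewrite ltr0n.
have -> : weyl_ratio p l.+1 = 2 * l.+1%:R / (2 * l.+1%:R + p) * weyl_ratio p l.
  by rewrite mulrAC -weyl_ratioS//; field; lra.
have h0 : 0 <= 2 * l.+1%:R / (2 * l.+1%:R + p) by rewrite divr_ge0; lra.
rewrite mulr_ge0//= mulr_ile1//; rewrite ler_pdivrMr; lra.
Qed.

Lemma coef_weyl_wave_le p n k : 0 <= p -> (0 < n)%N ->
  `|(weyl_wave p n)`_k| <= k`!%:R^-1.
Proof.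
move=> p0 n0; rewrite coef_weyl_wave; case: ifP => _.
  by rewrite normr0 invr_ge0.
have /andP[w0 w1] := weyl_ratio01 k./2 p0.
rewrite normrM normrM normrX normrN1 expr1n mul1r (ger0_norm w0).
have q0 : 0 <= 'C(n, k)%:R / n%:R ^+ k :> R by rewrite divr_ge0.
rewrite (ger0_norm q0); apply: le_trans (ler_piMl q0 w1) _.
have k0 : 0 < k`!%:R :> R by rewrite ltr0n fact_gt0.
rewrite ler_pdivrMr ?exprn_gt0 ?ltr0n// ler_pdivlMl// -natrM -natrX ler_nat.
rewrite mulnC bin_ffact ffact_prod -[k in (n ^ k)%N]card_ord -prod_nat_const.
by apply: leq_prod => i _; exact: leq_subr.
Qed.

Lemma coef_weyl_waveSS p n k : 0 <= p -> (0 < n)%N ->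
  k.+1%:R * (k.+2%:R + p) * (weyl_wave p n)`_k.+2 =
  - ((n%:R - k%:R) * (n%:R - k%:R - 1) / n%:R ^+ 2 * (weyl_wave p n)`_k).
Proof.
move=> p0 n0; rewrite !coef_weyl_wave /= negbK.
have [_|/negbTE ko] := boolP (odd k); first by rewrite !mulr0 oppr0.
have binS m : (m.+1%:R * 'C(n, m.+1)%:R = (n%:R - m%:R) * 'C(n, m)%:R :> R)%R.
  have [mn|nm] := leqP m n; first by rewrite -natrB// -!natrM mul_bin_left.
  by rewrite !bin_small ?mulr0// ltnW.
have hk : k.+2%:R = 2 * k./2.+1%:R :> R.
  by rewrite -natrM mul2n doubleS -{1}(odd_double_half k) ko.
have nn0 : n%:R != 0 :> R by rewrite pnatr_eq0 -lt0n.
transitivity (- ((-1) ^+ k./2 / n%:R ^+ k.+2) *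
    ((2 * k./2.+1%:R + p) * weyl_ratio p k./2.+1) *
    (k.+1%:R * 'C(n, k.+2)%:R)).
  by rewrite hk exprS; ring.
rewrite weyl_ratioS// -hk.
transitivity (- ((-1) ^+ k./2 / n%:R ^+ k.+2) * weyl_ratio p k./2 * k.+1%:R *
    (k.+2%:R * 'C(n, k.+2)%:R)); first by ring.
rewrite binS.
transitivity (- ((-1) ^+ k./2 / n%:R ^+ k.+2) * weyl_ratio p k./2 *
    (n%:R - k.+1%:R) * (k.+1%:R * 'C(n, k.+1)%:R)); first by ring.
rewrite binS -[k.+1%:R]natr1 !exprS.
by field; rewrite nn0/= expf_neq0.
Qed.

(** The two-term recurrence of the coefficients, of hypergeometric type, is a
    differential equation. As [n] tends to infinity it becomes
    [y ^+ 2 * T'' + p * y * T' + (y ^+ 2 - p) * T = - p]. *)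
Lemma weyl_wave_ode p n y : 0 <= p -> (0 < n)%N ->
  let T := weyl_wave p n in let e := n%:R^-1 in
  y ^+ 2 * T^`()^`().[y] + p * y * T^`().[y] - p * T.[y]
  + (e * y) ^+ 2 * (y ^+ 2 * T^`()^`().[y]
       - 2 * (n%:R - 1) * y * T^`().[y] + n%:R * (n%:R - 1) * T.[y]) = - p.
Proof.
move=> p0 n0 T e.
have nn0 : n%:R != 0 :> R by rewrite pnatr_eq0 -lt0n.
have T0 : T`_0 = 1.
  rewrite /T coef_weyl_wave/= bin0 expr0 /weyl_ratio rising_fact0.
  by rewrite !divr1 !mulr1.
have T1 : T`_1 = 0 by rewrite /T coef_weyl_wave.
have TSS k := coef_weyl_waveSS k p0 n0; rewrite -/T in TSS.
move: T T0 T1 TSS => T T0 T1 TSS.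
have cD1 k : ('X * T^`())`_k = k%:R * T`_k.
  by rewrite coefXM; case: k => [|k]; rewrite ?mul0r//= coef_deriv mulr_natl.
have cD2 k : ('X^2 * T^`()^`())`_k = k%:R * (k%:R - 1) * T`_k.
  rewrite coefXnM; case: k => [|[|k]]/=; rewrite ?mul0r ?subrr ?mulr0 ?mul0r//.
  rewrite subn2/= !coef_deriv -mulrnA -[LHS]mulr_natl natrM.
  by rewrite -[k.+2%:R]natr1 addrK.
have : 'X^2 * T^`()^`() + p *: ('X * T^`()) - p *: T
  + e ^+ 2 *: ('X^2 * ('X^2 * T^`()^`() - (2 * (n%:R - 1)) *: ('X * T^`())
     + (n%:R * (n%:R - 1)) *: T)) = (- p)%:P.
  apply/polyP => k.
  rewrite !(coefD, coefN, coefZ, cD1, cD2) coefXnM.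
  rewrite !(coefD, coefN, coefZ, cD1, cD2) coefC.
  case: k => [|[|k]]/=.
    by rewrite T0 !(mul0r, mulr0, mulr1, add0r, addr0).
    by rewrite T1 !(mulr0, subr0, addr0).
  have := TSS k; rewrite subn2/= -[k.+2%:R]natr1 -[k.+1%:R]natr1 /e.
  move: T`_k.+2 T`_k k%:R n%:R nn0 => t t' k' n' n'0 h.
  transitivity ((k' + 1) * (k' + 1 + 1 + p) * t
      + (n' - k') * (n' - k' - 1) / n' ^+ 2 * t'); first by field.
  by rewrite h addNr.
move=> /(congr1 (horner^~ y)); rewrite !(hornerE, horner_exp) => <-.
move: T.[y] T^`().[y] T^`()^`().[y] n%:R {nn0} => t0 t1 t2 n'.
by rewrite /=; ring.
Qed.

(** Far out, the limit equation forces [T] to follow [- p / y ^+ 2]. The scaled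
    difference [y ^+ 2 * (T + p / y ^+ 2)] is again a polynomial, and it solves
    an oscillator equation with friction [(p - 4) / y]: this is where [5 <= p]
    makes the friction strong enough. *)
Definition lifted_wave p n : {poly R} := 'X^2 * weyl_wave p n + p%:P.

Lemma lifted_waveE p n y :
  (lifted_wave p n).[y] = y ^+ 2 * (weyl_wave p n).[y] + p.
Proof. by rewrite /lifted_wave !(hornerE, horner_exp). Qed.

Lemma lifted_wave_derivE p n y : (lifted_wave p n)^`().[y] =
  2 * y * (weyl_wave p n).[y] + y ^+ 2 * (weyl_wave p n)^`().[y].
Proof.
rewrite /lifted_wave; move: (weyl_wave p n) => T.
by rewrite !(poly.derivE, hornerE, horner_exp) /=; ring.
Qed.

Lemma lifted_wave_deriv2E p n y : (lifted_wave p n)^`()^`().[y] =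
  2 * (weyl_wave p n).[y] + 4 * y * (weyl_wave p n)^`().[y]
  + y ^+ 2 * (weyl_wave p n)^`()^`().[y].
Proof.
rewrite /lifted_wave; move: (weyl_wave p n) => T.
by rewrite !(poly.derivE, hornerE, horner_exp) /=; ring.
Qed.

(** A common bound for the absolute values of the coefficients of [g'], of [g]
    and of [1] in the error term estimated below. *)
Definition wave_const p : R := 3 * p ^+ 2 + 5 * p + 6.

(** The terms that distinguish the equation for finite [n] from the limit
    equation all carry a factor of size at most [y ^+ 4 / n], so they stay
    bounded as long as [y ^+ 4 <= n]. *)
Lemma lifted_wave_ode p n y : 5 <= p -> (0 < n)%N ->
  1 <= y -> y ^+ 4 <= n%:R ->
  let g := lifted_wave p n in
  `|y ^+ 2 * g^`()^`().[y] + (p - 4) * y * g^`().[y] + y ^+ 2 * g.[y]|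
    <= wave_const p * (1 + `|g.[y]| + `|g^`().[y]|).
Proof.
move=> p5 n0 y1 yn /=; set g := lifted_wave p n.
have p0 : 0 <= p by lra.
have nn0 : 0 < n%:R :> R by rewrite ltr0n.
have := weyl_wave_ode y p0 n0 => /=.
set T := weyl_wave p n; set e := n%:R^-1 => ode.
have en : e * n%:R = 1 by rewrite mulVf// gt_eqF.
have ey : e * y ^+ 4 <= 1 by rewrite -en ler_wpM2l// invr_ge0 ltW.
have e0 : 0 <= e by rewrite invr_ge0 ltW.
set r := (X in `|X| <= _).
have gE := lifted_waveE p n y; have g1E := lifted_wave_derivE p n y.
have g2E := lifted_wave_deriv2E p n y.
rewrite -/g -/T in gE g1E g2E.
(* The equation solved for [r], with the factor of the leading term cleared. *)
have rE : (1 + (e * y) ^+ 2) * r =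
    ((p - 4) * (e * y) ^+ 2 * y + (2 + 2 * e) * e * y ^+ 3) * g^`().[y]
    + ((e * y) ^+ 2 * y ^+ 2 - (3 * e + 2 * e ^+ 2) * y ^+ 2 + 3 * (p - 2))
      * g.[y]
    + (p * (3 * e + 2 * e ^+ 2) * y ^+ 2 - 3 * p * (p - 2)).
  apply/eqP; rewrite -subr_eq0; apply/eqP.
  move: ode; rewrite /r gE g1E g2E.
  move: {r gE g1E g2E} T.[y] T^`().[y] T^`()^`().[y] => t0 t1 t2 ode.
  transitivity (y ^+ 2 * (y ^+ 2 * t2 + p * y * t1 - p * t0
      + (e * y) ^+ 2 * (y ^+ 2 * t2 - 2 * (n%:R - 1) * y * t1
           + n%:R * (n%:R - 1) * t0) + p)); last first.
    by rewrite ode addNr mulr0.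
  rewrite /e; move: n%:R nn0 {ode en ey e e0 yn} => m m0.
  by field; rewrite gt_eqF.
have e1 : e <= 1.
  by apply: le_trans ey; rewrite ler_peMr// exprn_ege1.
have eyk k : (k <= 4)%N -> 0 <= e * y ^+ k <= 1.
  move=> k4; rewrite mulr_ge0 ?exprn_ge0//=; last lra.
  by apply: le_trans ey; rewrite ler_wpM2l// ler_weXn2l.
have /andP[ey20 ey21] := eyk 2 isT.
have /andP[ey30 ey31] := eyk 3 isT.
have /andP[ey40 ey41] := eyk 4 isT.
have eM x : 0 <= x <= 1 -> 0 <= e * x <= 1.
  by move=> /andP[x0 x1]; rewrite mulr_ge0//= mulr_ile1.
have /andP[eey30 eey31] := eM _ (eyk 3 isT).
have /andP[eey20 eey21] := eM _ (eyk 2 isT).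
have /andP[eey40 eey41] := eM _ (eyk 4 isT).
have rs : `|r| <= `|(1 + (e * y) ^+ 2) * r|.
  by rewrite normrM ler_peMl// ger0_norm; have := sqr_ge0 (e * y); lra.
apply: le_trans rs _; rewrite {}rE /wave_const.
set K := _ + 6.
have K_lin : 3 * p + 6 <= K by rewrite /K; have := sqr_ge0 p; lra.
set A := (X in X * g^`().[y]); set B := (X in _ + X * g.[y] + _).
set C := (X in _ + _ + X).
have hA : `|A| <= K.
  have AE : A = (p - 4) * (e * (e * y ^+ 3)) + 2 * (e * y ^+ 3)
      + 2 * (e * (e * y ^+ 3)).
    by rewrite /A; ring.
  have h0 : 0 <= (p - 4) * (e * (e * y ^+ 3)) by rewrite mulr_ge0//; lra.
  have h1 : (p - 4) * (e * (e * y ^+ 3)) <= p - 4 by rewrite ler_piMr//; lra.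
  by rewrite ler_norml AE; apply/andP; split; lra.
have hB : `|B| <= K.
  have BE : B = e * (e * y ^+ 4) - 3 * (e * y ^+ 2) - 2 * (e * (e * y ^+ 2))
      + 3 * (p - 2).
    by rewrite /B; ring.
  by rewrite ler_norml BE; apply/andP; split; lra.
have hC : `|C| <= K.
  have CE : C = p * (3 * (e * y ^+ 2) + 2 * (e * (e * y ^+ 2)))
      - 3 * p ^+ 2 + 6 * p.
    by rewrite /C; ring.
  have h0 : 0 <= p * (3 * (e * y ^+ 2) + 2 * (e * (e * y ^+ 2))).
    by rewrite mulr_ge0//; lra.
  have h1 : p * (3 * (e * y ^+ 2) + 2 * (e * (e * y ^+ 2))) <= p * 5.
    by rewrite ler_wpM2l//; lra.
  have h2 : 5 * p <= p ^+ 2 by rewrite expr2 ler_wpM2r.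
  by rewrite ler_norml CE /K; apply/andP; split; lra.
rewrite (le_trans (ler_normD _ _))//.
rewrite (le_trans (lerD (ler_normD _ _) (lexx _)))//.
rewrite !normrM !mulrDr mulr1.
have := ler_wpM2r (normr_ge0 g.[y]) hB.
have := ler_wpM2r (normr_ge0 g^`().[y]) hA.
lra.
Qed.

(** Together with the next lemma, this bounds the waves and their derivatives
    at a fixed point uniformly in [n]. *)
Lemma horner_le_expR (P : {poly R}) y : 0 <= y ->
  (forall k, `|P`_k| <= k`!%:R^-1) -> `|P.[y]| <= expR y.
Proof.
move=> y0 hP; rewrite horner_coef (le_trans (ler_norm_sum _ _ _))//.
apply: (@le_trans _ _ (series (exp_coeff y) (size P))).
  rewrite /series/= big_mkord ler_sum// => k _.
  rewrite /exp_coeff/= normrM normrX (ger0_norm y0) mulrC.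
  by rewrite ler_wpM2l// exprn_ge0.
apply: nondecreasing_cvgn_le; last exact: is_cvg_series_exp_coeff.
apply/nondecreasing_seqP => k.
by rewrite seriesSr lerDl; exact: exp_coeff_ge0.
Qed.

Lemma deriv_coef_le_expR (P : {poly R}) :
  (forall k, `|P`_k| <= k`!%:R^-1) -> forall k, `|P^`()`_k| <= k`!%:R^-1.
Proof.
move=> hP k; rewrite coef_deriv normrMn -[leLHS]mulr_natl.
have k0 : 0 < k.+1%:R :> R by rewrite ltr0n.
rewrite -ler_pdivlMl// -invfM -natrM -factS; exact: hP.
Qed.

(** The energy estimate starts at a point that does not depend on [n], where the
    energy is bounded uniformly in [n]; so the rate at which the wave approaches
    [- p / y ^+ 2] is uniform as well. *)
Lemma weyl_wave_asymptotic p : 5 <= p -> exists2 a : R, 1 <= a &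
  forall y n, a <= y -> y ^+ 4 <= n%:R ->
    `|y ^+ 2 * (weyl_wave p n).[y] + p| <= p / 8.
Proof.
move=> p5; set q := p - 4; set K := wave_const p.
have K0 : 0 <= K by rewrite /K /wave_const; have := sqr_ge0 p; lra.
have q1 : 1 <= q by rewrite /q; lra.
set a := q ^+ 2 + q + 12 * K.
have qa : q <= a by rewrite /a; have := sqr_ge0 q; lra.
have a1 : 1 <= a := le_trans q1 qa.
(* [C] bounds the energy of every wave at the starting point [a]. *)
pose M := expR a.
pose G := a ^+ 2 * M + p.
pose G1 := 2 * a * M + a ^+ 2 * M.
pose C := a * (G ^+ 2 + G1 ^+ 2) + q * (G * G1) + 2 * K.
have energyC n : (0 < n)%N ->
    (oscillator_energy q K (lifted_wave p n)).[a] <= C.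
  move=> n0; rewrite oscillator_energyE.
  set g := lifted_wave p n.
  have hT := fun k => coef_weyl_wave_le k (le_trans (ler0n _ 5) p5) n0.
  have a0 : 0 <= a by lra.
  have T0 := horner_le_expR a0 hT.
  have T1 := horner_le_expR a0 (deriv_coef_le_expR hT).
  have gG : `|g.[a]| <= G.
    rewrite /g lifted_waveE.
    rewrite (le_trans (ler_normD _ _))// /G lerD//; last first.
      by rewrite ger0_norm; lra.
    by rewrite normrM ger0_norm ?exprn_ge0// ler_wpM2l// exprn_ge0.
  have gG1 : `|g^`().[a]| <= G1.
    rewrite /g lifted_wave_derivE.
    rewrite (le_trans (ler_normD _ _))// /G1 lerD// normrM ger0_norm.
    - by rewrite ler_wpM2l//; lra.
    - lra.
    - by rewrite ler_wpM2l// exprn_ge0.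
    - by rewrite exprn_ge0.
  rewrite /C lerD2r lerD//.
    rewrite ler_wpM2l// lerD//.
      rewrite -(real_normK (num_real g.[a])).
      by rewrite lerXn2r// nnegrE (le_trans _ gG).
    rewrite -(real_normK (num_real g^`().[a])).
    by rewrite lerXn2r// nnegrE (le_trans _ gG1).
  rewrite ler_wpM2l//; first by lra.
  by rewrite (le_trans (ler_norm _))// normrM ler_pM.
have C0 : 0 <= C.
  have M0 : 0 <= M by exact: expR_ge0.
  have G0 : 0 <= G by rewrite addr_ge0// ?mulr_ge0// ?exprn_ge0//; lra.
  have G10 : 0 <= G1 by rewrite addr_ge0// ?mulr_ge0// ?exprn_ge0//; lra.
  have a0 : 0 <= a by lra.
  have q0 : 0 <= q by lra.
  have h1 : 0 <= a * (G ^+ 2 + G1 ^+ 2).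
    by rewrite mulr_ge0// addr_ge0// sqr_ge0.
  have h2 : 0 <= q * (G * G1) by rewrite mulr_ge0// mulr_ge0.
  by rewrite /C; lra.
set c := 2 * (C / Num.sqrt a).
have c0 : 0 <= c by rewrite mulr_ge0 ?divr_ge0 ?sqrtr_ge0.
(* As soon as [D <= Num.sqrt y], the decay bound [c / Num.sqrt y] is at most
   [(p / 8) ^+ 2]. *)
set D := 64 * c / p ^+ 2 + 1.
have p2 : 0 < p ^+ 2 by rewrite exprn_gt0//; lra.
have D0 : 0 < D by rewrite ltr_wpDl// !mulr_ge0// invr_ge0 ltW.
exists (a + D ^+ 2); first by have := sqr_ge0 D; lra.
move=> y n ay yn.
have aly : a <= y by have := sqr_ge0 D; lra.
have n0 : (0 < n)%N.
  by rewrite -(ltr0n R); apply: lt_le_trans yn; rewrite exprn_gt0//; lra.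
have gode z : a <= z <= y ->
    `|z ^+ 2 * (lifted_wave p n)^`()^`().[z]
      + q * z * (lifted_wave p n)^`().[z] + z ^+ 2 * (lifted_wave p n).[z]|
    <= K * (1 + `|(lifted_wave p n).[z]| + `|(lifted_wave p n)^`().[z]|).
  move=> /andP[az zy]; apply: lifted_wave_ode => //; first by lra.
  by apply: le_trans yn; rewrite lerXn2r// nnegrE; lra.
have := damped_oscillator_decay q1 K0 qa (lexx _) gode.
move=> /(_ y); rewrite aly lexx => /(_ isT).
rewrite lifted_waveE; set g := y ^+ 2 * _ + p => decay.
have Dy : D <= Num.sqrt y.
  rewrite -(ger0_norm (ltW D0)) -sqrtr_sqr ler_wsqrtr//.
  by apply: le_trans ay; rewrite lerDr (le_trans ler01 a1).
have gc : D * g ^+ 2 <= c.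
  rewrite (le_trans (ler_wpM2r (sqr_ge0 g) Dy))// (le_trans decay)//.
  by rewrite /c ler_wpM2l// ler_wpM2r ?invr_ge0 ?sqrtr_ge0// energyC.
have gp : g ^+ 2 <= (p / 8) ^+ 2.
  rewrite -(ler_pM2l D0) (le_trans gc)//.
  have -> : D * (p / 8) ^+ 2 = c + p ^+ 2 / 64 by rewrite /D; field; lra.
  lra.
have p8 : 0 <= p / 8 by lra.
by rewrite -(ler_pXn2r (ltn0Sn 1)) ?nnegrE// real_normK ?num_real.
Qed.

End WeylWave.

Section FlatBallWeyl.
Context {R : realType}.
Implicit Types (x y : R) (n l : nat).

Lemma chord_integral_even l :
  chord_integral (2 * l) = 2 * l`!%:R / rising_fact (3 / 2 : R) l.
Proof.
have r0 m : 0 < rising_fact (3 / 2 : R) m by apply: rising_fact_gt0; lra.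
elim: l => [|l IH].
  by rewrite chord_integral0 rising_fact0 mulr1 divr1.
have h : (2 * l%:R + 3) * chord_integral (2 * l.+1)
    = (2 * l%:R + 2) * chord_integral (2 * l) :> R.
  by rewrite mulnS addnC -!natrM -!natrD chord_integralSS.
have l0 := ler0n R l; have rl := r0 l.
have -> : chord_integral (2 * l.+1) = (2 * l%:R + 2) / (2 * l%:R + 3)
    * chord_integral (2 * l) :> R.
  by rewrite mulrAC -h; field; lra.
rewrite IH rising_factS factS natrM -natr1.
by field; rewrite gt_eqF//=; lra.
Qed.

(** The integrals decrease with [k], so the closed form at even indices bounds
    the odd ones from below. *)
Lemma chord_integral_gt0 k : 0 < chord_integral k :> R.
Proof.
have even_gt0 l : 0 < chord_integral (2 * l) :> R.
  rewrite chord_integral_even !mulr_gt0 ?ltr0n ?fact_gt0// invr_gt0.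
  by apply: rising_fact_gt0; lra.
rewrite -(odd_double_half k); case: (odd k); last first.
  by rewrite add0n -mul2n.
apply: lt_le_trans (even_gt0 k./2.+1) _.
apply: le_Rintegral => //; [exact: integrable_half_chord..|].
move=> s _; rewrite mulnS mul2n.
have h1 : half_chord 1 s <= 1.
  rewrite -[leRHS]sqrtr1 ler_wsqrtr// expr1n; have := sqr_ge0 s; lra.
by rewrite add1n add2n exprS ler_piMl// ?exprn_ge0 ?sqrtr_ge0.
Qed.

Lemma unit_ball_volume_gt0 n : 0 < unit_ball_volume n :> R.
Proof. by apply: prodr_gt0 => k _; exact: chord_integral_gt0. Qed.

(** The quotients of Gamma values are rising factorials; the one at [3 / 2]
    cancels against the chord integral of even index. *)
Lemma weyl_poly_flat_ball p n : weyl_poly p (flat_ball R n) =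
  (2 * unit_ball_volume n) *:
    \sum_(l < (n %/ 2).+1) ('C(n, 2 * l)%:R * weyl_ratio p%:R l) *: 'X^(2 * l).
Proof.
rewrite /weyl_poly scaler_sumr; apply: eq_bigr => l _; rewrite scalerA.
congr (_ *: _).
have ln : (2 * l <= n)%N.
  by rewrite mulnC -leq_divRL// -ltnS.
rewrite /weyl_coef (minkowski_poly_flat_ball_coef ln) chord_integral_even.
have p0 := ler0n R p.
have p1 : 1 <= p%:R / 2 + 1 :> R by lra.
rewrite (_ : p%:R / 2 + l%:R + 1 = (p%:R / 2 + 1) + l%:R); last by ring.
rewrite (_ : l%:R + 2^-1 + 1 = 3 / 2 + l%:R :> R); last by field.
rewrite (_ : 2^-1 + 1 = 3 / 2 :> R); last by field.
rewrite !Gamma_rising//; last lra.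
rewrite /weyl_ratio.
have g1 := Gamma_gt0 p1.
have g2 : 0 < Gamma (3 / 2 : R) by apply: Gamma_gt0; lra.
have r1 : 0 < rising_fact (p%:R / 2 + 1 : R) l by apply: rising_fact_gt0; lra.
have r2 : 0 < rising_fact (3 / 2 : R) l by apply: rising_fact_gt0; lra.
by field; rewrite !gt_eqF.
Qed.

Lemma sum_even_powers n (s : nat -> R) :
  \sum_(l < (n %/ 2).+1) s l *: 'X^(2 * l)
    = \poly_(k < n.+1) (if odd k then 0 else s k./2).
Proof.
apply/polyP => k; rewrite coef_sum coef_poly.
under eq_bigr do rewrite coefZ coefXn.
have [ko|ke] := boolP (odd k).
  rewrite if_same big1// => l _; case: eqP => [kl|_]; last by rewrite mulr0.
  by move: ko; rewrite kl oddM.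
have k2 : k = (2 * k./2)%N by rewrite mul2n even_halfK.
have [kn|nk] := ltnP k n.+1.
  have ln : (k./2 < (n %/ 2).+1)%N by rewrite ltnS leq_divRL// mulnC -k2.
  rewrite (bigD1 (Ordinal ln))//= -k2 eqxx mulr1 big1 ?addr0// => l hl.
  case: eqP => [kl|_]; last by rewrite mulr0.
  by move/eqP: hl; case; apply: val_inj; rewrite /= kl mul2n doubleK.
rewrite big1// => l _; case: eqP => [kl|_]; last by rewrite mulr0.
by move: nk; rewrite ltnNge kl mulnC -leq_divRL// -ltnS ltn_ord.
Qed.

Lemma weyl_waveE (p : R) n : weyl_wave p n = \sum_(l < (n %/ 2).+1)
  ((-1) ^+ l * weyl_ratio p l * ('C(n, 2 * l)%:R / n%:R ^+ (2 * l)))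
    *: 'X^(2 * l).
Proof.
rewrite (sum_even_powers n (fun l =>
  (-1) ^+ l * weyl_ratio p l * ('C(n, 2 * l)%:R / n%:R ^+ (2 * l)))).
apply/polyP => k; rewrite !coef_poly.
case: ifP => // _; have [//|ke] := boolP (odd k).
by rewrite mul2n even_halfK.
Qed.

Lemma imaginary_expr_even y l :
  (0 +i* y)%C ^+ (2 * l) = ((-1) ^+ l * y ^+ (2 * l))%:C%C :> R[i].
Proof.
rewrite !exprM -exprMn mulN1r rmorphXn; congr (_ ^+ _).
by apply/eqP; rewrite eq_complex/=; apply/andP; split; apply/eqP; ring.
Qed.

Lemma complex_weyl_poly_imaginary p n y : (0 < n)%N ->
  (complex_weyl_poly p (flat_ball R n)).[(0 +i* y)%C]
    = (2 * unit_ball_volume n * (weyl_wave p%:R n).[n%:R * y])%:C%C.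
Proof.
move=> n0; rewrite /complex_weyl_poly weyl_poly_flat_ball map_polyZ hornerZ /=.
rewrite [in RHS]rmorphM; congr (_ * _).
rewrite weyl_waveE [map_poly _ _]rmorph_sum !horner_sum [RHS]rmorph_sum.
apply: eq_bigr => l _.
rewrite /= map_polyZ map_polyXn !hornerZ !hornerXn imaginary_expr_even -rmorphM.
congr (_%:C%C); rewrite exprMn.
have nn : n%:R ^+ (2 * l) != 0 :> R by rewrite expf_neq0// pnatr_eq0 -lt0n.
by field.
Qed.

End FlatBallWeyl.

(** * Real-rootedness *)

Section RealRooted.
Context {R : realType}.
Implicit Types (p a b c x y : R) (s : seq R) (f : R -> R).

Definition real_rooted f :=
  exists c s, forall y, f y = c * \prod_(x <- s) (y - x).

(** Away from its roots the absolute value of a real-rooted polynomial is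
    log-concave: the distance from the midpoint to a root outside [a, b] is the
    arithmetic mean of its distances from [a] and [b], hence at least their
    geometric mean. *)
Lemma real_rooted_midpoint f a b : a <= b -> real_rooted f ->
  (forall y, a <= y <= b -> f y != 0) ->
  f a * f b <= f ((a + b) / 2) ^+ 2.
Proof.
move=> ab [c [s fE]] f0; set m := (a + b) / 2.
have s_out x : x \in s -> ~~ (a <= x <= b).
  move=> xs; apply/negP => /f0; rewrite fE => /negP; apply.
  by rewrite mulf_eq0 (big_rem x)//= subrr mul0r eqxx orbT.
rewrite !fE exprMn mulrACA -expr2 ler_wpM2l ?sqr_ge0//.
rewrite -big_split/= -prodrXl big_seq [leRHS]big_seq.
apply: ler_prod => x /s_out; rewrite negb_and -!ltNge => xab.
apply/andP; split; last by rewrite /m; have := sqr_ge0 (a - b); lra.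
by case/orP : xab => h; [apply: mulr_ge0|apply: mulr_le0]; lra.
Qed.

(** The function [- p / y ^+ 2] has no zero on [a, 3 * a] and is log-convex
    there: at [a], [2 * a] and [3 * a] the midpoint inequality would say
    [1 / 9 <= 1 / 16]. The error [p / 8] is small enough to keep this false. *)
Lemma weyl_wave_not_real_rooted p : 5 <= p ->
  exists N, forall n, (N <= n)%N -> ~ real_rooted (horner (weyl_wave p n)).
Proof.
move=> p5; have [a a1 wave] := weyl_wave_asymptotic p5.
have [N hN] : exists N, (3 * a) ^+ 4 <= N%:R.
  exists (Num.truncn ((3 * a) ^+ 4)).+1; apply/ltW/truncnS_gt.
exists N => n Nn rr; set T := weyl_wave p n in rr.
have {}wave y : a <= y <= 3 * a -> `|y ^+ 2 * T.[y] + p| <= p / 8.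
  move=> /andP[ay ya]; apply: wave => //.
  apply: (le_trans _ (le_trans hN _)); last by rewrite ler_nat.
  by rewrite lerXn2r// nnegrE; lra.
have Tneg y : a <= y <= 3 * a ->
    - (9 / 8 * p) <= y ^+ 2 * T.[y] <= - (7 / 8 * p).
  by move=> /wave; rewrite ler_norml => /andP[h1 h2]; apply/andP; split; lra.
have T0 y : a <= y <= 3 * a -> T.[y] != 0.
  move=> /Tneg/andP[_]; apply: contraTneq => ->; rewrite mulr0 -ltNge; lra.
have := real_rooted_midpoint _ rr T0.
move=> /(_ ltac:(lra)); rewrite (_ : (a + 3 * a) / 2 = 2 * a); last by field.
have /andP[_ A1] := Tneg a ltac:(lra).
have /andP[_ A3] := Tneg (3 * a) ltac:(lra).
have /andP[A2 A2'] := Tneg (2 * a) ltac:(lra).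
move: A1 A2 A2' A3; rewrite !exprMn.
move: T.[a] T.[2 * a] T.[3 * a] => t1 t2 t3 A1 A2 A2' A3 mid.
have a2 : 0 < a ^+ 2 by rewrite exprn_gt0//; lra.
have low : (7 / 8 * p) ^+ 2 <= (a ^+ 2 * t1) * (3 ^+ 2 * a ^+ 2 * t3).
  by rewrite -[leRHS]mulrNN expr2; apply: ler_pM; lra.
have up : (2 ^+ 2 * a ^+ 2 * t2) ^+ 2 <= (9 / 8 * p) ^+ 2.
  by rewrite -sqrrN lerXn2r// ?nnegrE; lra.
have := ler_wpM2l (ltW (exprn_gt0 2 a2)) mid.
have : 0 < p ^+ 2 by rewrite exprn_gt0//; lra.
lra.
Qed.

(** Along the imaginary axis, a polynomial with purely imaginary roots that
    takes real values there is real-rooted: the constant [c] absorbs the powers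
    of the imaginary unit contributed by the linear factors. *)
Lemma imaginary_roots_real_rooted (P : {poly R[i]}) f :
  (forall z : R[i], root P z -> complex.Re z = 0) ->
  (forall y, P.[(0 +i* y)%C] = (f y)%:C%C) -> real_rooted f.
Proof.
move=> rootP PE; have [s Ps] := closed_field_poly_normal P.
pose k := lead_coef P * (0 +i* 1)%C ^+ size s.
exists (complex.Re k), [seq complex.Im z | z <- s] => y.
have im z : lead_coef P != 0 -> z \in s -> z = (0 +i* complex.Im z)%C.
  move=> P0 zs; have /rootP : root P z.
    by rewrite Ps rootZ// root_prod_XsubC.
  by case: z {zs} => x t /= ->.
rewrite big_map; set r := \prod_(z <- s) _.
suff Pk : P.[(0 +i* y)%C] = k * r%:C%C.
  have := congr1 (@complex.Re R) (PE y); rewrite Pk /= => <-.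
  by case: (k) => u v /=; rewrite mulr0 subr0.
rewrite {1}Ps hornerZ horner_prod /k /r.
have [->|/im {}im] := eqVneq (lead_coef P) 0; first by rewrite !mul0r.
rewrite -mulrA; congr (_ * _).
elim: s im {Ps k r} => [|z s IH] im; first by rewrite !big_nil expr0 mul1r.
rewrite !big_cons exprS rmorphM/= mulrACA -IH; last first.
  by move=> x xs; apply: im; rewrite inE xs orbT.
congr (_ * _); rewrite hornerXsubC (im z) ?mem_head//=.
by apply/eqP; rewrite eq_complex/=; apply/andP; split; apply/eqP; ring.
Qed.

End RealRooted.

Lemma real_rooted_rescale (R : realType) (f : R -> R) a b : a != 0 -> b != 0 ->
  real_rooted (fun y => a * f (b * y)) -> real_rooted f.
Proof.
move=> a0 b0 [c [s fE]].
exists (a^-1 * c * b ^- size s), [seq b * x | x <- s] => y.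
have -> : f y = a^-1 * (c * \prod_(x <- s) (b^-1 * y - x)).
  by rewrite -fE mulVKf// mulKf.
rewrite big_map -!mulrA; congr (_ * (_ * _)).
rewrite -exprVn; elim: s {fE} => [|x s IH].
  by rewrite !big_nil expr0 mulr1.
rewrite !big_cons IH exprS; move: (\prod_(_ <- s) _) => q.
by field.
Qed.

Theorem theorem2p6 (R : realType) (p : nat) (p_ge5 : (5 <= p)%N) :
  exists N : nat, forall n : nat, (N <= n)%N ->
    let U := flat_ball R n in
    let W := complex_weyl_poly p U in
    is_minkowski_poly U (minkowski_poly U) /\
    ~ conservative W /\
    exists z : R[i], root W z /\ complex.Re z != 0.
Proof.
have p5 : 5 <= p%:R :> R by rewrite (ler_nat R 5 p).
have [N wave] := weyl_wave_not_real_rooted p5.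
exists (maxn N 1) => n; rewrite geq_max => /andP[Nn n0] U W.
split; first by rewrite (minkowski_polyE (is_minkowski_poly_flat_ball n));
  exact: is_minkowski_poly_flat_ball.
suff [z [Wz z0]] : exists z : R[i], root W z /\ complex.Re z != 0.
  split; last by exists z.
  by move=> /(_ z Wz)[/eqP]; rewrite (negbTE z0).
apply: contrapT => noroot; apply: (wave n Nn).
have imag z : root W z -> complex.Re z = 0.
  move=> Wz; apply/eqP/negPn/negP => z0.
  by apply: noroot; exists z.
have := imaginary_roots_real_rooted imag
  (fun y => complex_weyl_poly_imaginary p y n0).
by apply: real_rooted_rescale; rewrite ?pnatr_eq0 -?lt0n// gt_eqF// mulr_gt0//;
  exact: unit_ball_volume_gt0.
Qed.
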